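(* Let $\mathcal{W}(F)$ be a $d$-web defined by the presentation polynomial $P_F(z;x,y)=a_0(x,y)z^d+\cdots+a_d(x,y)$. If the vector field $X=\alpha_1\partial_x+\alpha_2\partial_y$ is a symmetry of the web $\mathcal{W}(F)$, then the discriminant $\Delta$ of $P_F$ is a Darboux polynomial of $X$.
   Context: Let $F(x,y,y')=a_0(x,y)(y')^d+a_1(x,y)(y')^{d-1}+\cdots+a_d(x,y)=0$, $y'=dy/dx$, be a first-order differential equation, polynomial of degree $d$ in $y'$, with coefficients $a_i\in\mathbb{C}\{x,y\}$, the ring of analytic functions in $x,y$. Its presentation polynomial is $P_F(z;x,y)=a_0(x,y)z^d+\cdots+a_d(x,y)$, so that $F(x,y,y')=P_F(y';x,y)$. Let $R_{P_F}$ be the resultant in $z$ of $P_F$ and $\partial_zP_F$. One works throughout outside the singular locus, i.e. under the condition $R_{P_F}\neq 0$; then $P_F$ has $d$ distinct roots $p_1(x,y),\dots,p_d(x,y)$ in $z$ and $P_F=a_0\prod_{i=1}^d(z-p_i)$. The implicit $d$-web $\mathcal{W}(F)$ is the family of the $d$ foliations of the plane, in general position, given by the equations $y'=p_i(x,y)$, $i=1,\dots,d$. The $z$-discriminant of $P_F$ is $\Delta=a_0^{2d-2}\prod_{1\le i<j\le d}(p_i-p_j)^2$, and $R_{P_F}=(-1)^{d(d-1)/2}a_0\Delta$. A vector field $X=\alpha_1\partial_x+\alpha_2\partial_y$, with $\alpha_1,\alpha_2$ analytic functions of $(x,y)$, is a symmetry of $\mathcal{W}(F)$ if it is an infinitesimal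 generator of a local Lie group of transformations leaving the web globally invariant, i.e. of a symmetry group of each equation $y'=p_i(x,y)$; equivalently, for each $i=1,\dots,d$, $$-\alpha_1\partial_x(p_i)-\alpha_2\partial_y(p_i)+\partial_x(\alpha_2)+(\partial_y(\alpha_2)-\partial_x(\alpha_1))p_i-\partial_y(\alpha_1)p_i^2=0.$$ For a polynomial vector field $X$ and a polynomial $g$, one says that $g$ is a Darboux polynomial of $X$ (the curve $\{g=0\}$ is invariant under $X$) if there is a polynomial $K$, called the cofactor, with $X(g)=Kg$. The same terminology is used here for the analytic objects $X$ and $\Delta$: there is an analytic cofactor $K$ with $X(\Delta)=K\Delta$. *)

(* Defs.v *)
From mathcomp Require Import all_boot all_order all_algebra.
From mathcomp Require Import all_classical all_reals all_analysis.
From mathcomp Require Import complex.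
Set Implicit Arguments. Unset Strict Implicit. Unset Printing Implicit Defensive.
Import Order.TTheory GRing.Theory Num.Theory numFieldNormedType.Exports.
Local Open Scope classical_set_scope.
Local Open Scope ring_scope.

(* The field R[i] seen as a numClosedFieldType: it is on this form of the type
   that the topology and the normed space structure given by the modulus are
   inferred. *)
Definition Cplx (R : realType) : numClosedFieldType := R[i].

(* f is the sum, on a polydisc of radius r > 0 around x0, of a power series
   that converges absolutely for the radius r. The multi-indices m with all
   components < N exhaust NN^n when N tends to infinity. In a
   numClosedFieldType, 0 < r and 0 <= M mean that r and M are real, so these
   are the usual real bounds. *)
Definition analytic_at (C : numClosedFieldType) (n : nat)
    (f : 'rV[C]_n -> C) (x0 : 'rV[C]_n) : Prop :=
  exists (c : {ffun 'I_n -> nat} -> C) (r M : C),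
    [/\ 0 < r, 0 <= M,
      forall N : nat, \sum_(m : {ffun 'I_n -> 'I_N})
        `|c [ffun i => m i : nat]| * r ^+ (\sum_i m i)%N <= M
    & forall x : 'rV[C]_n, (forall i, `|x 0 i - x0 0 i| < r) ->
        (fun N : nat => \sum_(m : {ffun 'I_n -> 'I_N})
           c [ffun i => m i : nat] * \prod_i (x 0 i - x0 0 i) ^+ m i)
        @ \oo --> f x].

Definition analytic_on (C : numClosedFieldType) (n : nat)
    (D : set 'rV[C]_n) (f : 'rV[C]_n -> C) : Prop :=
  forall x, D x -> analytic_at f x.

(* A point (x, y) of the plane is the row vector q with x = q 0 0, y = q 0 1. *)
Definition vec2 (C : numClosedFieldType) (x y : C) : 'rV[C]_2 :=
  \row_j (if j == 0 then x else y).

(* X(g) for X = alpha1 d/dx + alpha2 d/dy *)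
Definition vfield_app (C : numClosedFieldType)
    (alpha1 alpha2 g : 'rV[C]_2 -> C) (q : 'rV[C]_2) : C :=
  alpha1 q * 'D_(vec2 1 0) g q + alpha2 q * 'D_(vec2 0 1) g q.

(* 'D_v g q is a junk value when g is not derivable, hence the analyticity of
   g is part of the definition. *)
Definition is_darboux (C : numClosedFieldType) (D : set 'rV[C]_2)
    (alpha1 alpha2 g : 'rV[C]_2 -> C) : Prop :=
  analytic_on D g /\
  exists K : 'rV[C]_2 -> C, analytic_on D K /\
    forall q, D q -> vfield_app alpha1 alpha2 g q = K q * g q.

(* a_0 z^d + a_1 z^(d-1) + ... + a_d. It is used with A := 'rV[C]_2 -> C, the
   ring of functions of (x, y), for P_F itself, and with A := C for the
   polynomial P_F(z; q) at a point q. *)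
Definition pres_poly (A : comNzRingType) (d : nat) (a : 'I_d.+1 -> A) :
    {poly A} :=
  \sum_(i < d.+1) a i *: 'X^(d - i).

Definition pres_at (C : numClosedFieldType) (d : nat)
    (a : 'I_d.+1 -> 'rV[C]_2 -> C) (q : 'rV[C]_2) : {poly C} :=
  pres_poly (fun i => a i q).

(* The resultant is taken in the ring of functions, before evaluation: the
   Sylvester matrix keeps its size at the points where a_0 vanishes, and
   R_{P_F} vanishes there. *)
Definition web_resultant (C : numClosedFieldType) (d : nat)
    (a : 'I_d.+1 -> 'rV[C]_2 -> C) : 'rV[C]_2 -> C :=
  resultant (pres_poly a) (pres_poly a)^`().

(* The complement of the singular locus. That R_{P_F} is not the zero germ at
   any point of an open set U amounts to U `<=` closure (regular_locus U a). *)
Definition regular_locus (C : numClosedFieldType) (d : nat)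
    (U : set 'rV[C]_2) (a : 'I_d.+1 -> 'rV[C]_2 -> C) : set 'rV[C]_2 :=
  U `&` [set q | web_resultant a q != 0].

(* P = lead_coef P * prod_i (z - p_i); roots are listed with multiplicity, in
   an order on which the (symmetric) discriminant does not depend. *)
Definition roots_seq (C : numClosedFieldType) (P : {poly C}) : seq C :=
  sval (closed_field_poly_normal P).

Definition web_discriminant (C : numClosedFieldType) (d : nat)
    (a : 'I_d.+1 -> 'rV[C]_2 -> C) (q : 'rV[C]_2) : C :=
  let p := roots_seq (pres_at a q) in
  a ord0 q ^+ (2 * d - 2) *
  \prod_(i < d) \prod_(j < d | (i < j)%N) (p`_i - p`_j) ^+ 2.

(* w is a nonzero vector tangent at q to one of the leaves y' = p_i through q,
   i.e. w is proportional to (1, p_i(q)). *)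
Definition web_tangent (C : numClosedFieldType) (d : nat)
    (a : 'I_d.+1 -> 'rV[C]_2 -> C) (q w : 'rV[C]_2) : Prop :=
  exists c z : C, [/\ c != 0, root (pres_at a q) z & w = c *: vec2 1 z].

(* X generates, near each point of the regular locus, an analytic local
   one-parameter group of transformations (t, q) |-> phi t q which leaves the
   web globally invariant: the differential of phi t at q, which is
   w |-> 'D_w (phi t) q, maps the tangent directions of the web at q to those
   of the web at phi t q. The variables (t, x, y) are grouped in a row vector
   of size 1 + 2. *)
Definition web_symmetry (C : numClosedFieldType) (d : nat)
    (U : set 'rV[C]_2) (a : 'I_d.+1 -> 'rV[C]_2 -> C)
    (alpha1 alpha2 : 'rV[C]_2 -> C) : Prop :=
  forall q0, regular_locus U a q0 ->
  exists (V : set 'rV[C]_2) (r : C) (phi : C -> 'rV[C]_2 -> 'rV[C]_2),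
    [/\ [/\ open V, V q0, V `<=` regular_locus U a & 0 < r],
        forall j, analytic_on
          [set u : 'rV[C]_(1 + 2) | `|lsubmx u 0 0| < r /\ V (rsubmx u)]
          (fun u => phi (lsubmx u 0 0) (rsubmx u) 0 j),
        (forall q, V q -> phi 0 q = q) /\
        (forall s t q, `|s| < r -> `|t| < r -> `|s + t| < r ->
           V q -> V (phi t q) -> phi (s + t) q = phi s (phi t q)),
        forall q, V q ->
          'D_1 (fun t : C => phi t q) 0 = vec2 (alpha1 q) (alpha2 q)
      & forall t q, `|t| < r -> V q ->
          regular_locus U a (phi t q) /\
          forall w, web_tangent a q w ->
            web_tangent a (phi t q) ('D_w (phi t) q)].

(* Main.v *)
From HB Require Import structures.
Require Import Defs.
From mathcomp Require Import all_boot all_order all_algebra separable.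
From mathcomp Require Import all_classical all_reals all_analysis.
From mathcomp Require mpoly.
Import (canonicals, coercions) mpoly.
From mathcomp Require Import complex ring.
Import Order.TTheory GRing.Theory Num.Theory numFieldNormedType.Exports.
Local Open Scope classical_set_scope.
Local Open Scope ring_scope.
Set Implicit Arguments. Unset Strict Implicit. Unset Printing Implicit Defensive.

(** Let delta be the product of the (p_i - p_j)^2, so that the discriminant is
a_0^(2d-2) delta. If A, B, E, F are the entries of the Jacobian matrix at q of the
time-t flow phi_t, then phi_t maps the direction (1, p) to a multiple of
(1, (E + F p) / (A + B p)). A symmetry sends leaf directions to leaf directions;
at a regular point the d slopes are distinct, so their images under this homography
are all the slopes at phi_t q, and
    delta(phi_t q) * prod_i (A + B p_i)^(2(d-1)) = (A F - B E)^(d(d-1)) * delta(q)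
([square_differences_homography], [web_delta_homography]). The Jacobian matrix is
the identity at t = 0 and, by symmetry of second derivatives, its time derivative
there is the matrix of the partial derivatives of alpha1 and alpha2
([flow_jacobian_velocity]). Differentiating the identity at t = 0 and using
sum_i p_i = - a_1 / a_0 gives X(delta) = k delta with
    k = d(d-1) (d_y alpha2 - d_x alpha1) + 2(d-1) (a_1 / a_0) d_y alpha1
([web_delta_symmetry]), hence X(Delta) = K Delta at the regular points, with
K = (2d-2) X(a_0) / a_0 + k ([web_discriminant_symmetry]).

The function K only involves the coefficients of the equation and of X and their
derivatives, so it is analytic where a_0 does not vanish, also at singular points.
So is Delta: by the theorem on symmetric polynomials delta is a polynomial in the
a_i / a_0 ([web_delta_coef], [analytic_web_delta]). As X(Delta) - K Delta is
continuous and vanishes on the regular locus, which is dense, it vanishes wherever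
a_0 does not.

This needs the elementary theory of analytic functions of several complex
variables: stability under products, inverses and partial derivatives,
differentiability, and symmetry of second derivatives. All of it is read off the
coefficients of the power series. The only convergence argument is that at a point
whose coordinates are at most theta * r in modulus, the terms of degree at least N
contribute at most theta^N times a bound of the series of moduli at radius r
([tail_le]). *)

(** * Multi-indices *)

Section MultiIndices.
Variable n : nat.
Implicit Types (m k l : {ffun 'I_n -> nat}) (i j : 'I_n) (N : nat).

Definition mdeg m : nat := (\sum_i m i)%N.

(** The cubes exhaust the multi-indices; sums over them are sums over sequences, so
that cubes of different sizes can be compared. *)
Definition cube N : seq {ffun 'I_n -> nat} :=
  [seq [ffun i => m i : nat] | m : {ffun 'I_n -> 'I_N} <- enum {ffun 'I_n -> 'I_N}].

Definition mle k m : bool := [forall i, (k i <= m i)%N].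

Definition msub m k : {ffun 'I_n -> nat} := [ffun i => (m i - k i)%N].

Definition unit_index j : {ffun 'I_n -> nat} := [ffun i => (i == j : nat)].

Lemma cube_uniq N : uniq (cube N).
Proof.
rewrite map_inj_uniq ?enum_uniq// => m m' /ffunP mm'; apply/ffunP => i.
by apply/val_inj; have := mm' i; rewrite !ffunE.
Qed.

Lemma mem_cube N m : (m \in cube N) = [forall i, (m i < N)%N].
Proof.
apply/mapP/forallP => [[m' _ ->] i|mN]; first by rewrite ffunE.
exists [ffun i => Ordinal (mN i)]; first by rewrite mem_enum.
by apply/ffunP => i; rewrite !ffunE.
Qed.

Lemma cube_sub N N' : (N <= N')%N -> {subset cube N <= cube N'}.
Proof.
move=> NN' m; rewrite !mem_cube => /forallP mN; apply/forallP => i.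
exact: leq_trans (mN i) NN'.
Qed.

Lemma leq_mdeg m i : (m i <= mdeg m)%N.
Proof. by rewrite /mdeg (bigD1 i)//= leq_addr. Qed.

Lemma mem_cube_mdeg m : m \in cube (mdeg m).+1.
Proof. by rewrite mem_cube; apply/forallP => i; rewrite ltnS leq_mdeg. Qed.

Lemma mdegN_cube N m : m \notin cube N -> (N <= mdeg m)%N.
Proof.
rewrite mem_cube negb_forall => /existsP[j]; rewrite -leqNgt => /leq_trans; apply.
exact: leq_mdeg.
Qed.

Lemma mdegD k l : mdeg (k + l) = (mdeg k + mdeg l)%N.
Proof. by rewrite /mdeg -big_split/=; apply: eq_bigr => i _; rewrite ffunE. Qed.

Lemma mdeg0 : mdeg 0 = 0%N.
Proof. by rewrite /mdeg big1// => i _; rewrite ffunE. Qed.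

Lemma mdeg_eq0 m : (mdeg m == 0%N) = (m == 0).
Proof.
apply/eqP/eqP => [|->]; last exact: mdeg0.
move=> m0; apply/ffunP => i; rewrite ffunE; apply/eqP.
by rewrite -leqn0 -m0 leq_mdeg.
Qed.

Lemma mdeg_unit j : mdeg (unit_index j) = 1%N.
Proof.
rewrite /mdeg (bigD1 j)//= ffunE eqxx big1 ?addn0// => i ij.
by rewrite ffunE (negPf ij).
Qed.

Lemma mleP k m : reflect (forall i, (k i <= m i)%N) (mle k m).
Proof. exact: forallP. Qed.

Lemma mleD k l : mle k (k + l).
Proof. by apply/mleP => i; rewrite ffunE leq_addr. Qed.

Lemma mle0 m : mle 0 m.
Proof. by apply/mleP => i; rewrite ffunE. Qed.

Lemma msubK k m : mle k m -> k + msub m k = m.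
Proof.
by move=> /mleP km; apply/ffunP => i; rewrite !ffunE; have := subnKC (km i).
Qed.

Lemma msub0 m : msub m 0 = m.
Proof. by apply/ffunP => i; rewrite !ffunE subn0. Qed.

Lemma maddK k l : msub (k + l) k = l.
Proof. by apply/ffunP => i; rewrite !ffunE; exact: addKn. Qed.

Lemma mem_cube_mle N k m : mle k m -> m \in cube N -> k \in cube N.
Proof.
move=> /mleP km; rewrite !mem_cube => /forallP mN; apply/forallP => i.
exact: leq_ltn_trans (km i) (mN i).
Qed.

Lemma mem_cube_msub N k m : m \in cube N -> msub m k \in cube N.
Proof.
apply: mem_cube_mle; apply/mleP => i; rewrite ffunE; exact: leq_subr.
Qed.

Lemma big_cube (V : nmodType) N (F : {ffun 'I_n -> nat} -> V) :
  \sum_(m : {ffun 'I_n -> 'I_N}) F [ffun i => m i : nat] =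
  \sum_(m <- cube N) F m.
Proof. by rewrite big_map big_enum. Qed.

(** The multi-indices below a given one form a finite set, so any cube that
contains the largest of them gives the same sum. *)
Lemma big_mle_cube (V : nmodType) N m (F : {ffun 'I_n -> nat} -> V) :
  m \in cube N ->
  \sum_(k <- cube (mdeg m).+1 | mle k m) F k = \sum_(k <- cube N | mle k m) F k.
Proof.
move=> mN; rewrite -[LHS]big_filter -[RHS]big_filter; apply: perm_big.
apply: uniq_perm; rewrite ?filter_uniq ?cube_uniq// => k.
rewrite !mem_filter; case: (boolP (mle k m)) => //= km.
by rewrite !(mem_cube_mle km) ?mem_cube_mdeg.
Qed.

(** Substitution m = k + l. *)
Lemma big_cube_shift (V : nmodType) N k (F : {ffun 'I_n -> nat} -> V) :
  \sum_(m <- cube N | mle k m) F (msub m k) =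
  \sum_(l <- cube N | k + l \in cube N) F l.
Proof.
rewrite -[RHS]big_filter -[LHS]big_filter.
rewrite -(big_map (msub^~ k) xpredT F); apply: perm_big.
have inj : {in [seq m <- cube N | mle k m] &, injective (msub^~ k)}.
  move=> m m'; rewrite !mem_filter => /andP[km _] /andP[km' _] e.
  by rewrite -(msubK km) e msubK.
apply: uniq_perm.
- by rewrite map_inj_in_uniq// filter_uniq// cube_uniq.
- by rewrite filter_uniq// cube_uniq.
move=> l; rewrite mem_filter; apply/mapP/andP => [[m]|[klN lN]].
  by rewrite mem_filter => /andP[km mN] ->; rewrite msubK// mN mem_cube_msub.
by exists (k + l); rewrite ?maddK// mem_filter mleD klN.
Qed.

Lemma ler_sum_cube (K : numDomainType) N N' (F : {ffun 'I_n -> nat} -> K) :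
  (N <= N')%N -> (forall m, 0 <= F m) ->
  \sum_(m <- cube N) F m <= \sum_(m <- cube N') F m.
Proof.
move=> NN' F0; rewrite [leRHS](bigID (mem (cube N)))/=.
suff -> : \sum_(m <- cube N' | m \in cube N) F m = \sum_(m <- cube N) F m.
  by rewrite lerDl sumr_ge0.
rewrite -[LHS]big_filter; apply: perm_big; apply: uniq_perm.
- by rewrite filter_uniq ?cube_uniq.
- exact: cube_uniq.
move=> m; rewrite mem_filter; apply: andb_idr; exact: cube_sub.
Qed.

Lemma big_cubeB (V : zmodType) N N' (F : {ffun 'I_n -> nat} -> V) :
  (N <= N')%N ->
  \sum_(m <- cube N') F m - \sum_(m <- cube N) F m =
  \sum_(m <- cube N' | m \notin cube N) F m.
Proof.
move=> NN'; rewrite [X in X - _](bigID (mem (cube N)))/= addrAC.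
suff -> : \sum_(m <- cube N' | m \in cube N) F m = \sum_(m <- cube N) F m.
  by rewrite subrr add0r.
rewrite -[LHS]big_filter; apply: perm_big; apply: uniq_perm.
- by rewrite filter_uniq ?cube_uniq.
- exact: cube_uniq.
move=> m; rewrite mem_filter; apply: andb_idr; exact: cube_sub.
Qed.

Lemma multi_index_ind (P : {ffun 'I_n -> nat} -> Prop) :
  P 0 -> (forall m j, P m -> P (unit_index j + m)) -> forall m, P m.
Proof.
move=> P0 PS m; have [d] := ubnP (mdeg m); elim: d m => // d IH m.
have [->//|m0 md] := eqVneq m 0.
have /existsP[j mj] : [exists j, (0 < m j)%N].
  apply: contra_neqT m0; rewrite negb_exists => /forallP m0.
  by apply/ffunP => i; apply/eqP; rewrite ffunE; have := m0 i; case: (m i).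
have jm : mle (unit_index j) m.
  by apply/mleP => i; rewrite ffunE; case: eqP => // ->.
rewrite -(msubK jm); apply/PS/IH; move: md.
by rewrite -{1}(msubK jm) mdegD mdeg_unit.
Qed.

End MultiIndices.

(** * Partial sums of power series *)

Section PowerSeries.
Variables (K : numFieldType) (n : nat).
Local Notation mi := {ffun 'I_n -> nat}.
Implicit Types (c b : mi -> K) (m k l : mi) (y h : 'rV[K]_n).

Definition mpow y m : K := \prod_i y 0 i ^+ m i.

Definition psum c N y : K := \sum_(m <- cube n N) c m * mpow y m.

(** Partial sum of the series of moduli, at the point whose coordinates are all r. *)
Definition wsum c N (r : K) : K := \sum_(m <- cube n N) `|c m| * r ^+ mdeg m.

(** Coefficients of the product of two series. The cube only serves to make the range
finite: it contains every k below m. *)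
Definition conv c b m : K :=
  \sum_(k <- cube n (mdeg m).+1 | mle k m) c k * b (msub m k).

Lemma mpow0 y : mpow y 0 = 1.
Proof. by rewrite /mpow big1// => i _; rewrite ffunE expr0. Qed.

Lemma mpowD y k l : mpow y (k + l) = mpow y k * mpow y l.
Proof.
by rewrite /mpow -big_split/=; apply: eq_bigr => i _; rewrite ffunE exprD.
Qed.

Lemma mpow_unit y j : mpow y (unit_index j) = y 0 j.
Proof.
rewrite /mpow (bigD1 j)//= ffunE eqxx expr1 big1 ?mulr1// => i ij.
by rewrite ffunE (negPf ij) expr0.
Qed.

Lemma mpow_at0 m : mpow 0 m = (m == 0)%:R.
Proof.
have [->|m0] := eqVneq m 0; first by rewrite mpow0.
have /existsP[j mj] : [exists j, m j != 0%N].
  apply: contra_neqT m0; rewrite negb_exists => /forallP m0.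
  by apply/ffunP => i; apply/eqP; rewrite ffunE; have := m0 i; rewrite negbK.
by rewrite /mpow (bigD1 j)//= mxE expr0n (negPf mj) mul0r.
Qed.

Lemma norm_mpow_le y (s : K) m :
  (forall i, `|y 0 i| <= s) -> `|mpow y m| <= s ^+ mdeg m.
Proof.
move=> ys; rewrite normr_prod /mdeg -prodrXr; apply: ler_prod => i _.
by rewrite normr_ge0/= normrX lerXn2r// ?nnegrE// (le_trans _ (ys i)).
Qed.

Lemma wsum_ge0 c N r : 0 <= r -> 0 <= wsum c N r.
Proof. by move=> r0; rewrite sumr_ge0// => m _; rewrite mulr_ge0// exprn_ge0. Qed.

Lemma wsum_le c N (r s M : K) : 0 <= s -> s <= r -> wsum c N r <= M ->
  wsum c N s <= M.
Proof.
move=> s0 sr; apply: le_trans; apply: ler_sum => m _.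
by rewrite ler_wpM2l// lerXn2r// nnegrE// (le_trans s0).
Qed.

(** Inside the polydisc the terms of degree at least d are smaller than on its
boundary by a factor theta^d; all convergence statements rest on this. *)
Lemma tail_le c N d (Q : pred mi) (r theta M : K) y :
  0 <= r -> 0 <= theta <= 1 -> wsum c N r <= M ->
  (forall i, `|y 0 i| <= theta * r) ->
  (forall m, Q m -> (d <= mdeg m)%N) ->
  \sum_(m <- cube n N | Q m) `|c m * mpow y m| <= theta ^+ d * M.
Proof.
move=> r0 /andP[t0 t1] cM yr Qd.
apply: (@le_trans _ _ (theta ^+ d * wsum c N r)); last first.
  by rewrite ler_wpM2l// exprn_ge0.
rewrite /wsum mulr_sumr big_mkcond/=; apply: ler_sum => m _.
have p0 : 0 <= theta ^+ d * (`|c m| * r ^+ mdeg m).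
  by rewrite !mulr_ge0// exprn_ge0.
case: ifP => // /Qd dm; rewrite normrM mulrCA ler_wpM2l//.
apply: (le_trans (norm_mpow_le _ yr)); rewrite exprMn ler_wpM2r ?exprn_ge0//.
exact: ler_wiXn2l.
Qed.

Lemma psumB_le c N N' (r theta M : K) y : (N <= N')%N ->
  0 <= r -> 0 <= theta <= 1 -> wsum c N' r <= M ->
  (forall i, `|y 0 i| <= theta * r) ->
  `|psum c N' y - psum c N y| <= theta ^+ N * M.
Proof.
move=> NN' r0 t01 cM yr; rewrite /psum big_cubeB//.
apply: (le_trans (ler_norm_sum _ _ _)).
by apply: tail_le yr _ => // m; exact: mdegN_cube.
Qed.

(** There are finitely many coordinates, so the strict inequalities leave a uniform
margin; theta is the ratio in the geometric bounds. *)
Lemma polydisc_contract y (r : K) : 0 < r -> (forall i, `|y 0 i| < r) ->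
  exists theta, [/\ 0 <= theta, theta < 1 & forall i, `|y 0 i| <= theta * r].
Proof.
move=> r0 yr.
suff [t [t0 t1 yt]] : exists t : K,
    [/\ 0 <= t, t < 1 & forall i, i \in enum 'I_n -> `|y 0 i| <= t * r].
  by exists t; split=> // i; apply: yt; rewrite mem_enum.
elim: (enum 'I_n) => [|i s [t [t0 t1 yt]]]; first by exists 0.
have yi : `|y 0 i| = `|y 0 i| / r * r by rewrite divfK// gt_eqF.
have yi0 : 0 <= `|y 0 i| / r by rewrite divr_ge0// ltW.
have yi1 : `|y 0 i| / r < 1 by rewrite ltr_pdivrMr// mul1r.
have [tyi|yit] := real_leP (ger0_real t0) (ger0_real yi0).
  exists (`|y 0 i| / r); split=> // j; rewrite inE => /orP[/eqP->|/yt yj].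
    by rewrite -yi.
  by apply: (le_trans yj); rewrite ler_wpM2r// ltW.
exists t; split=> // j; rewrite inE => /orP[/eqP->|/yt//].
by rewrite yi ler_wpM2r// ltW.
Qed.

Lemma conv_sum c b N :
  \sum_(m <- cube n N) conv c b m =
  \sum_(k <- cube n N) \sum_(l <- cube n N | k + l \in cube n N) c k * b l.
Proof.
rewrite (eq_big_seq (fun m => \sum_(k <- cube n N | mle k m) c k * b (msub m k))).
  rewrite (exchange_big_dep xpredT)//=; apply: eq_bigr => k _.
  by rewrite (big_cube_shift N k (fun l => c k * b l)).
by move=> m mN; rewrite /conv -(big_mle_cube _ mN).
Qed.

Lemma convZ c b y m :
  conv c b m * mpow y m =
  conv (fun m => c m * mpow y m) (fun m => b m * mpow y m) m.
Proof.
rewrite /conv mulr_suml; apply: eq_bigr => k km.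
by rewrite mulrACA -mpowD msubK.
Qed.

Lemma norm_conv_le c b m :
  `|conv c b m| <= conv (fun m => `|c m|) (fun m => `|b m|) m.
Proof.
apply: (le_trans (ler_norm_sum _ _ _)); apply: ler_sum => k _.
by rewrite normrM.
Qed.

(** The sum of moduli is submultiplicative, since pairs of multi-indices whose sum is
in a cube are themselves in the cube. *)
Lemma wsum_conv c b N (r : K) : 0 <= r ->
  wsum (conv c b) N r <= wsum c N r * wsum b N r.
Proof.
move=> r0; set c' := fun m => `|c m| * r ^+ mdeg m.
set b' := fun m => `|b m| * r ^+ mdeg m.
apply: (@le_trans _ _ (\sum_(m <- cube n N) conv c' b' m)).
  apply: ler_sum => m _.
  have := norm_conv_le c b m; move/(ler_wpM2r (exprn_ge0 (mdeg m) r0)).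
  move/le_trans; apply; rewrite /conv mulr_suml; apply: ler_sum => k km.
  by rewrite /c' /b' mulrACA -exprD -mdegD msubK.
rewrite conv_sum /wsum mulr_suml; apply: ler_sum => k _.
rewrite mulr_sumr [leRHS](bigID (fun l => k + l \in cube n N))/= lerDl.
by rewrite sumr_ge0// => l _; rewrite !mulr_ge0// ?exprn_ge0.
Qed.

(** The product of the partial sums and the partial sum of the product differ by
terms c_k b_l in which the degree of k + l is at least N. *)
Lemma psum_conv_le c b N (r theta M M' : K) y :
  0 <= r -> 0 <= theta <= 1 -> 0 <= M -> 0 <= M' ->
  wsum c N r <= M -> wsum b N r <= M' ->
  (forall i, `|y 0 i| <= theta * r) ->
  `|psum c N y * psum b N y - psum (conv c b) N y| <= theta ^+ N * (M * M').
Proof.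
move=> r0 /andP[t0 t1] M0 M'0 cM bM yr.
have -> : psum (conv c b) N y = \sum_(k <- cube n N)
    \sum_(l <- cube n N | k + l \in cube n N) (c k * mpow y k) * (b l * mpow y l).
  rewrite -(conv_sum (fun m => c m * mpow y m) (fun m => b m * mpow y m)).
  by apply: eq_bigr => m _; rewrite convZ.
have -> : psum c N y * psum b N y = \sum_(k <- cube n N)
    \sum_(l <- cube n N) (c k * mpow y k) * (b l * mpow y l).
  by rewrite /psum mulr_suml; apply: eq_bigr => k _; rewrite mulr_sumr.
rewrite -sumrB; apply: (le_trans (ler_norm_sum _ _ _)).
apply: (@le_trans _ _ (\sum_(k <- cube n N)
    theta ^+ N * (`|c k| * r ^+ mdeg k) * M')); last first.
  by rewrite -mulr_suml -mulr_sumr -mulrA ler_wpM2l ?exprn_ge0// ler_wpM2r.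
apply: ler_sum => k _.
rewrite [X in `|X - _|](bigID (fun l => k + l \in cube n N))/= addrAC subrr add0r.
apply: (le_trans (ler_norm_sum _ _ _)).
apply: (@le_trans _ _ (\sum_(l <- cube n N)
    theta ^+ N * (`|c k| * r ^+ mdeg k) * (`|b l| * r ^+ mdeg l))); last first.
  by rewrite -mulr_sumr ler_wpM2l// !mulr_ge0// exprn_ge0.
rewrite big_mkcond/=; apply: ler_sum => l _.
have pos : 0 <= theta ^+ N * (`|c k| * r ^+ mdeg k) * (`|b l| * r ^+ mdeg l).
  by rewrite !mulr_ge0// exprn_ge0.
case: ifP => // /mdegN_cube; rewrite mdegD => Nkl.
rewrite mulrACA -mpowD normrM normrM -(mulrA (theta ^+ N)) (mulrACA `|c k|).
rewrite (mulrCA (theta ^+ N)) ler_wpM2l ?mulr_ge0//.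
apply: (le_trans (norm_mpow_le _ yr)).
rewrite mdegD exprMn -(exprD r) ler_wpM2r ?exprn_ge0//.
exact: ler_wiXn2l.
Qed.

Lemma psum_at0 c N : psum c N.+1 0 = c 0.
Proof.
rewrite /psum (eq_bigr (fun m => if m == 0 then c m else 0)); last first.
  by move=> m _; rewrite mpow_at0; case: eqP; rewrite (mulr1, mulr0).
rewrite -big_mkcond/= -big_filter (perm_big [:: 0]) ?big_seq1//.
apply: uniq_perm; rewrite ?filter_uniq ?cube_uniq// => m.
rewrite mem_filter inE; apply: andb_idr => /eqP ->.
by rewrite mem_cube; apply/forallP => i; rewrite ffunE.
Qed.

Lemma conv_split0 c b m :
  conv c b m = c 0 * b m +
    \sum_(k <- cube n (mdeg m).+1 | mle k m && (k != 0)) c k * b (msub m k).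
Proof.
rewrite /conv -big_filter (bigD1_seq 0)/=; last 2 first.
- by rewrite mem_filter mle0 mem_cube; apply/forallP => i; rewrite ffunE.
- by rewrite filter_uniq ?cube_uniq.
by rewrite msub0 big_filter_cond.
Qed.

(** A series with invertible constant term has a formal inverse: the
coefficients are determined one degree at a time. *)
Lemma conv_inverse c : c 0 != 0 ->
  exists b, forall m, conv c b m = (m == 0)%:R.
Proof.
move=> c0.
pose step (g : mi -> K) m : K := (c 0)^-1 * ((m == 0)%:R -
  \sum_(k <- cube n (mdeg m).+1 | mle k m && (k != 0)) c k * g (msub m k)).
pose B s := iter s step (fun=> 0).
have BS s m : B s.+1 m = step (B s) m by [].
have Bs s s' m : (mdeg m < s)%N -> (mdeg m < s')%N -> B s m = B s' m.
  elim: s s' m => [//|s IH] [//|s'] m ms ms'; rewrite !BS /step.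
  congr (_ * (_ - _)); apply: eq_bigr => k /andP[km k0]; congr (_ * _).
  have mk : (mdeg (msub m k) < mdeg m)%N.
    by rewrite -{2}(msubK km) mdegD -[ltnLHS]add0n ltn_add2r lt0n mdeg_eq0.
  by apply: IH; apply: leq_trans mk _.
have [b bE Bb] : exists2 b, forall m, b m = step (B (mdeg m)) m &
    forall t m, (mdeg m < t)%N -> B t m = b m.
  by exists (fun m => B (mdeg m).+1 m) => // t m mt; exact: Bs.
exists b => m; rewrite conv_split0 bE /step mulrA divff// mul1r.
rewrite -[RHS]addr0 -addrA; congr (_ + _); apply/eqP; rewrite addrC subr_eq0.
apply/eqP; apply: eq_bigr => k /andP[km k0]; congr (_ * _).
rewrite Bb// -{2}(msubK km) mdegD -[ltnLHS]add0n ltn_add2r lt0n.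
by rewrite mdeg_eq0.
Qed.

(** When the non-constant part of c is at most |c 0| / 2, the recursive relation for
the coefficients of b bounds the sum S of their moduli by 1 / |c 0| + S / 2. *)
Lemma wsum_inverse c b N (r : K) : 0 <= r -> c 0 != 0 ->
  (forall m, conv c b m = (m == 0)%:R) ->
  wsum (fun m => if m == 0 then 0 else c m) N r <= `|c 0| / 2 ->
  wsum b N r <= 2 / `|c 0|.
Proof.
move=> r0 c0 cb cs; set c' := fun m => _ in cs.
have c0p : 0 < `|c 0| by rewrite normr_gt0.
have eqb m : c 0 * b m = (m == 0)%:R - conv c' b m.
  rewrite -cb !conv_split0 /c' eqxx mul0r add0r [X in _ - X](eq_bigr
    (fun k => c k * b (msub m k))) ?addrK//.
  by move=> k /andP[_ /negPf ->].
have H : `|c 0| * wsum b N r <= 1 + `|c 0| / 2 * wsum b N r.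
  apply: (@le_trans _ _ (\sum_(m <- cube n N) (m == 0)%:R +
      wsum (conv c' b) N r)).
    rewrite /wsum mulr_sumr -big_split/=; apply: ler_sum => m _.
    rewrite mulrA -normrM eqb; apply: (@le_trans _ _
      (((m == 0)%:R + `|conv c' b m|) * r ^+ mdeg m)).
      rewrite ler_wpM2r ?exprn_ge0//; apply: (le_trans (ler_normB _ _)).
      by rewrite normr_nat.
    rewrite mulrDl lerD2r; case: eqP => [->|_]; last by rewrite mul0r.
    by rewrite mdeg0 mulr1.
  apply: lerD; last first.
    apply: (le_trans (wsum_conv _ _ _ r0)); rewrite ler_wpM2r// wsum_ge0//.
  rewrite (eq_bigr (fun m => if m == 0 then 1 else 0)); last first.
    by move=> m _; case: eqP.
  rewrite -big_mkcond/= big_const_seq iter_addr_0 -[leRHS]/(1%:R) ler_nat.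
  rewrite (@eq_count _ _ (pred1 0))//.
  by rewrite count_uniq_mem ?cube_uniq// leq_b1.
have : `|c 0| / 2 * wsum b N r <= 1.
  rewrite -(lerD2r (`|c 0| / 2 * wsum b N r)) -mulrDl -splitr.
  exact: H.
by rewrite mulrC -ler_pdivlMr ?divr_gt0// invf_div mul1r.
Qed.

End PowerSeries.

(** * Termwise differentiation of partial sums *)

Section TermwiseDerivative.
Variables (K : numFieldType) (n : nat).
Local Notation mi := {ffun 'I_n -> nat}.
Implicit Types (c b : mi -> K) (m k l : mi) (y h : 'rV[K]_n) (i j : 'I_n).

(** Coefficients of the j-th partial derivative of the series. *)
Definition dcoef j c m : K := (m j).+1%:R * c (unit_index j + m).

(** The differential at y of the m-th monomial, applied to h. Where m j = 0 the
truncated difference is meaningless, but it comes with the factor 0. *)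
Definition mderiv y h m : K :=
  \sum_j h 0 j * ((m j)%:R * mpow y (msub m (unit_index j))).

Lemma mderiv_unit y h j m :
  mderiv y h (unit_index j + m) = h 0 j * mpow y m + y 0 j * mderiv y h m.
Proof.
rewrite /mderiv mulr_sumr (bigD1 j)//= [in RHS](bigD1 j)//= addrA.
congr (_ + _).
  rewrite maddK !ffunE eqxx -[(1 + m j)%R]/(1 + m j)%N natrD mulrDl mul1r mulrDr.
  congr (_ + _); rewrite [RHS]mulrCA; congr (_ * _).
  have [->|mj] := eqVneq (m j) 0%N; first by rewrite !mulr0n !mul0r !mulr0.
  rewrite [RHS]mulrCA; congr (_ * _); rewrite -mpow_unit -mpowD msubK//.
  by apply/mleP => i; rewrite ffunE; case: eqP => // ->; rewrite lt0n.
apply: eq_bigr => i ij; rewrite [RHS]mulrCA; congr (_ * _).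
rewrite !ffunE (negPf ij) -[(0 + m i)%R]/(m i).
have [->|mi0] := eqVneq (m i) 0%N; first by rewrite !mulr0n !mul0r !mulr0.
rewrite [RHS]mulrCA; congr (_ * _); rewrite -mpow_unit -mpowD; congr mpow.
apply/ffunP => k; rewrite !ffunE -[RHS]/(_ + _)%N -[X in (X - _)%N]/(_ + _)%N.
case: (eqVneq k i) => [->|_]; last by rewrite !subn0.
by rewrite (negPf ij).
Qed.

(** By induction on the number of factors of the monomial, like the next lemma. As s
bounds the coordinates of y and of h, each factor contributes at most 2 s. *)
Lemma mpowB_le y h (s eta : K) m : 0 < s -> 0 <= eta <= s ->
  (forall i, `|y 0 i| <= s) -> (forall i, `|h 0 i| <= eta) ->
  `|mpow (y + h) m - mpow y m| <= eta / s * (2 * s) ^+ mdeg m.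
Proof.
move=> s0 /andP[eta0 es] ys he.
elim/multi_index_ind: m => [|m j IH].
  by rewrite !mpow0 subrr normr0 mdeg0 expr0 mulr1 divr_ge0// ltW.
have yh2 i : `|(y + h) 0 i| <= 2 * s.
  by rewrite mxE mulr_natl mulr2n (le_trans (ler_normD _ _))// lerD// (le_trans (he i)).
rewrite !mpowD !mpow_unit mdegD mdeg_unit [(2 * s) ^+ _]exprS.
set P := mpow (y + h) m; set Q := mpow y m; set D := (2 * s) ^+ _.
have -> : (y + h) 0 j * P - y 0 j * Q = y 0 j * (P - Q) + h 0 j * P.
  by rewrite mxE mulrDl mulrBr addrAC.
have -> : eta / s * (2 * s * D) = s * (eta / s * D) + eta * D.
  by field; rewrite gt_eqF.
apply: (le_trans (ler_normD _ _)); rewrite !normrM lerD// ler_pM//.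
exact: norm_mpow_le.
Qed.

Lemma mpow_taylor_le y h (s eta : K) m : 0 < s -> 0 <= eta <= s ->
  (forall i, `|y 0 i| <= s) -> (forall i, `|h 0 i| <= eta) ->
  `|mpow (y + h) m - mpow y m - mderiv y h m|
    <= (eta / s) ^+ 2 * (2 * s) ^+ mdeg m.
Proof.
move=> s0 /andP[eta0 es] ys he.
have es0 : 0 <= eta / s by rewrite divr_ge0// ltW.
elim/multi_index_ind: m => [|m j IH].
  rewrite !mpow0 subrr mdeg0 expr0 mulr1 sub0r normrN /mderiv big1.
    by rewrite normr0 exprn_ge0.
  by move=> i _; rewrite ffunE mulr0n mul0r mulr0.
have := @mpowB_le y h s eta m s0 _ ys he; rewrite eta0 es => /(_ isT) PQ.
rewrite !mpowD !mpow_unit mdegD mdeg_unit [(2 * s) ^+ _]exprS mderiv_unit.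
set P := mpow (y + h) m in IH PQ *; set Q := mpow y m in IH PQ *.
set L := mderiv y h m in IH *; set D := (2 * s) ^+ _ in IH PQ *.
have -> : (y + h) 0 j * P - y 0 j * Q - (h 0 j * Q + y 0 j * L) =
    y 0 j * (P - Q - L) + h 0 j * (P - Q) by rewrite mxE; ring.
have -> : (eta / s) ^+ 2 * (2 * s * D) =
    s * ((eta / s) ^+ 2 * D) + eta * (eta / s * D).
  by field; rewrite gt_eqF.
by apply: (le_trans (ler_normD _ _)); rewrite !normrM lerD// ler_pM.
Qed.

(** Halving the radius absorbs the factor m_j + 1 brought by differentiation, because
k <= 2^k. *)
Lemma wsum_dcoef c j N (s M : K) : 0 < s ->
  wsum c N.+1 (2 * s) <= M -> wsum (dcoef j c) N s <= M / s.
Proof.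
move=> s0 cM; rewrite ler_pdivlMr//; apply: le_trans cM.
pose F m := `|c m| * (2 * s) ^+ mdeg m.
have F0 m : 0 <= F m by rewrite mulr_ge0// exprn_ge0// mulr_ge0// ltW.
pose G l := if unit_index j + l \in cube n N.+1 then F (unit_index j + l) else 0.
apply: (@le_trans _ _ (\sum_(l <- cube n N) G l)).
  rewrite /wsum mulr_suml !big_seq; apply: ler_sum => l lN; rewrite /G ifT.
    rewrite /dcoef /F normrM normr_nat [(l j).+1%:R * _]mulrC -!mulrA ler_wpM2l//.
    rewrite -exprSr mdegD mdeg_unit add1n exprMn.
    rewrite ler_wpM2r ?exprn_ge0 ?(ltW s0)// -natrX ler_nat.
    apply: leq_trans (ltn_expl _ (ltnSn 1)); rewrite ltnS.
    by apply: leq_trans (leq_mdeg l j) _.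
  move: lN; rewrite !mem_cube => /forallP lN; apply/forallP => i.
  by rewrite !ffunE -[(_ + _)%R]/(_ + _)%N ltnS (leq_trans _ (lN i))//; case: (i == j).
apply: (@le_trans _ _ (\sum_(l <- cube n N.+1) G l)).
  by apply: ler_sum_cube => // l; rewrite /G; case: ifP.
rewrite /G -big_mkcond/= -(big_cube_shift _ _ (fun l => F (unit_index j + l))).
rewrite /wsum [leRHS](bigID (mle (unit_index j)))/=.
rewrite (eq_bigr (fun m => `|c m| * (2 * s) ^+ mdeg m)); last first.
  by move=> m jm; rewrite /F msubK.
by rewrite lerDl sumr_ge0// => m _; exact: F0.
Qed.

Lemma psum_mderiv c N y h :
  \sum_(m <- cube n N) c m * mderiv y h m =
  \sum_j h 0 j * \sum_(l <- cube n N | unit_index j + l \in cube n N)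
    dcoef j c l * mpow y l.
Proof.
under eq_bigr do rewrite mulr_sumr; rewrite exchange_big/=.
apply: eq_bigr => j _; rewrite mulr_sumr.
rewrite -(big_cube_shift _ _ (fun l => h 0 j * (dcoef j c l * mpow y l))).
rewrite [in RHS]big_mkcond/=; apply: eq_bigr => m _.
case: ifPn => [jm|]; last first.
  move=> /mleP/existsNP[k]; rewrite ffunE; case: eqP => // -> /negP.
  by rewrite -leqNgt leqn0 => /eqP ->; rewrite mulr0n !(mul0r, mulr0).
rewrite mulrCA; congr (_ * _); rewrite /dcoef msubK// mulrA [_ * c m]mulrC.
congr (_ * _%:R * _); rewrite !ffunE eqxx subn1 prednK//.
by have /mleP/(_ j) := jm; rewrite ffunE eqxx.
Qed.

(** First-order Taylor formula for the partial sums. The last term comes from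
the terms that differentiation pushes out of the cube. *)
Lemma psum_taylor_le c N y h (s theta eta M : K) :
  0 < s -> 0 <= eta <= s -> 0 <= theta <= 1 ->
  (forall N, wsum c N (2 * s) <= M) ->
  (forall i, `|y 0 i| <= theta * s) -> (forall i, `|h 0 i| <= eta) ->
  `|psum c N (y + h) - psum c N y - \sum_j h 0 j * psum (dcoef j c) N y|
    <= (eta / s) ^+ 2 * M + \sum_(j < n) eta * (theta ^+ N.-1 * (M / s)).
Proof.
move=> s0 eta0s t01 cM ys he.
have ys' i : `|y 0 i| <= s.
  by apply: (le_trans (ys i)); rewrite ger_pMl//; case/andP: t01.
pose T := \sum_(m <- cube n N) c m * (mpow (y + h) m - mpow y m - mderiv y h m).
pose S := \sum_j h 0 j * \sum_(l <- cube n N | unit_index j + l \notin cube n N)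
    dcoef j c l * mpow y l.
have -> : psum c N (y + h) - psum c N y - \sum_j h 0 j * psum (dcoef j c) N y
    = T - S.
  have -> : T = psum c N (y + h) - psum c N y -
      \sum_(m <- cube n N) c m * mderiv y h m.
    by rewrite /T -!sumrB; apply: eq_bigr => m _; rewrite !mulrBr.
  rewrite psum_mderiv -[RHS]addrA -opprD; congr (_ - _); rewrite /S -big_split/=; apply: eq_bigr => j _.
  rewrite -mulrDr; congr (_ * _).
  by rewrite /psum [LHS](bigID (fun l => unit_index j + l \in cube n N)).
apply: (le_trans (ler_normB _ _)); apply: lerD.
  apply: (@le_trans _ _ ((eta / s) ^+ 2 * wsum c N (2 * s))); last first.
    rewrite ler_wpM2l// exprn_ge0// divr_ge0 ?(ltW s0)//; by case/andP: eta0s.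
  apply: (le_trans (ler_norm_sum _ _ _)); rewrite /wsum mulr_sumr.
  apply: ler_sum => m _; rewrite normrM mulrCA ler_wpM2l//.
  exact: mpow_taylor_le.
apply: (le_trans (ler_norm_sum _ _ _)); apply: ler_sum => j _.
rewrite normrM ler_pM//; apply: (le_trans (ler_norm_sum _ _ _)).
apply: (tail_le (ltW s0) t01 (wsum_dcoef j s0 (cM _)) ys) => l.
by move/mdegN_cube; rewrite mdegD mdeg_unit -leq_subLR subn1.
Qed.

(** This is where the symmetry of second derivatives comes from. *)
Lemma dcoefC c i j m : dcoef i (dcoef j c) m = dcoef j (dcoef i c) m.
Proof.
rewrite /dcoef !mulrA [unit_index j + (_ + _)]addrCA; congr (_ * _).
rewrite -!natrM !ffunE -![(_ + m _)%R]/(_ + m _)%N; congr _%:R.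
by rewrite (eq_sym j); case: eqVneq => [->|_] //; rewrite !add0n mulnC.
Qed.

End TermwiseDerivative.

(** * Limits of complex sequences *)

Section ComplexLimits.
Variable R : realType.
Local Notation C := (Cplx R).

Lemma Cplx_real (x : C) : 0 <= x -> exists2 r : R, 0 <= r & x = r%:C%C :> R[i].
Proof.
move=> x0; exists (complex.Re (x : R[i])).
  by rewrite -ler0c RRe_real// ger0_real.
by rewrite RRe_real// ger0_real.
Qed.

Lemma cvg_geometric0 (theta : C) : 0 <= theta < 1 ->
  (fun N : nat => theta ^+ N) @ \oo --> (0 : C).
Proof.
move=> /andP[]/Cplx_real[t t0 ->] t1.
have {}t1 : t < 1 by rewrite -ltcR.
apply/cvgrPdist_lt => e /[dup] e0 /ltW/Cplx_real[r r0 re].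
have {}r0 : 0 < r by rewrite -ltcR -re.
have /cvgrPdist_lt/(_ _ r0) : (fun N : nat => t ^+ N) @ \oo --> (0 : R).
  by apply: cvg_expr; rewrite ger0_norm.
apply: filterS => N; rewrite !sub0r !normrN re -ltcR; congr (_ < _).
by rewrite -rmorphXn/= normc_def/= expr0n/= addr0 sqrtr_sqr.
Qed.

Lemma near_eq_seq (u v : nat -> C) (l : C) (N0 : nat) :
  (forall N, (N0 <= N)%N -> v N = u N) -> u @ \oo --> l -> v @ \oo --> l.
Proof.
move=> uv ul; apply: cvg_trans ul; apply: near_eq_cvg.
by exists N0 => // N /= /uv.
Qed.

Lemma cvg_geometricM (theta B : C) : 0 <= theta < 1 ->
  (fun N : nat => theta ^+ N * B) @ \oo --> (0 : C).
Proof.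
move=> t01; have := cvgM (cvg_geometric0 t01) (cvg_cst B).
by rewrite mul0r; exact.
Qed.

(** Completeness of the complex numbers, from that of the real and imaginary parts. *)
Lemma Cplx_cauchy (u : nat -> C) :
  (forall e : C, 0 < e -> exists N : nat,
     forall N' : nat, (N <= N')%N -> `|u N' - u N| < e) ->
  exists l : C, u @ \oo --> l.
Proof.
move=> uC.
have cauchy (f : R[i] -> R) : (forall z w, f (z - w) = f z - f w) ->
    (forall z, `|f z|%:C%C <= `|z|) ->
    exists a : R, (fun N => f (u N)) @ \oo --> a.
  move=> fB fz; apply/cvg_ex; apply: cauchy_cvg; apply: cauchy_exP => e e0.
  have [|N uN] := uC (e%:C%C); first by rewrite ltcR.
  exists (f (u N)); exists N => // N' /= NN'; rewrite /ball/= -ltcR.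
  have := fz (u N' - u N); rewrite fB distrC => /le_lt_trans; apply.
  exact: uN.
have [||a ua] := cauchy (@complex.Re R).
- by case=> ? ? [].
- exact: normc_ge_Re.
have [||b ub] := cauchy (@complex.Im R).
- by case=> ? ? [].
- move=> z; rewrite -normrN -ReiNIm; apply: (le_trans (normc_ge_Re _)).
  by rewrite normrM [X in _ * X]normc_def/= expr0n expr1n add0r sqrtr1 mulr1.
exists (a +i* b)%C; apply/cvgrPdist_lt => e /[dup] e0 /ltW/Cplx_real[r r0 re].
have {}r0 : 0 < r by rewrite -ltcR -re.
have r20 : 0 < r / 2 by rewrite divr_gt0.
have /cvgrPdist_lt/(_ _ r20) ua' := ua.
have /cvgrPdist_lt/(_ _ r20) ub' := ub.
apply: filterS2 ua' ub' => N; move: (u N) => [c d] /= ac bd; rewrite re.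
have -> : ((a +i* b)%C - (c +i* d)%C : R[i]) =
    (a - c)%:C%C + 'i%C * (b - d)%:C%C.
  by simpc.
apply: (le_lt_trans (ler_normD _ _)).
rewrite normrM [X in X * _]normc_def/= expr0n expr1n add0r sqrtr1 mul1r.
by rewrite !normc_def/= expr0n !addr0 !sqrtr_sqr -rmorphD/= ltcR [r]splitr ltrD.
Qed.

Lemma seq_cvg_unique (u : nat -> C) (a b : C) :
  u @ \oo --> a -> u @ \oo --> b -> a = b.
Proof. by move=> ua ub; rewrite (cvg_unique _ ua ub). Qed.

(** The order on complex numbers is partial; the limit of v - |u| is nonnegative
because it is also the limit of the modulus of v - |u|. *)
Lemma cvg_norm_le (u v : nat -> C) (l b : C) :
  u @ \oo --> l -> v @ \oo --> b -> (forall N, `|u N| <= v N) -> `|l| <= b.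
Proof.
move=> ul vb uv; rewrite -subr_ge0.
have w : (fun N => v N - `|u N|) @ \oo --> b - `|l|.
  exact: cvgB vb (cvg_norm ul).
have w' : (fun N => v N - `|u N|) @ \oo --> `|b - `|l| |.
  rewrite (_ : (fun N => _) = (fun N => `|v N - `|u N| |)); first exact: cvg_norm.
  by apply/funext => N; rewrite [RHS]ger0_norm// subr_ge0.
by rewrite (seq_cvg_unique w w').
Qed.

End ComplexLimits.

(** * Stability properties of analytic functions *)

Section AnalyticFunctions.
Variables (R : realType) (n : nat).
Local Notation C := (Cplx R).
Local Notation mi := {ffun 'I_n -> nat}.
Implicit Types (c b : mi -> C) (f g : 'rV[C]_n -> C) (x y h : 'rV[C]_n).

Lemma analytic_atP f x : analytic_at f x <->
  exists c (r M : C), [/\ 0 < r, 0 <= M, forall N, wsum c N r <= M &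
    forall y, (forall i, `|y 0 i| < r) ->
      (fun N => psum c N y) @ \oo --> f (x + y)].
Proof.
have wE c r N : \sum_(m : {ffun 'I_n -> 'I_N})
    `|c [ffun i => m i : nat]| * r ^+ (\sum_i m i)%N = wsum c N r.
  rewrite /wsum -big_cube; apply: eq_bigr => m _; congr (_ * _ ^+ _).
  by apply: eq_bigr => i _; rewrite ffunE.
have pE c y N : \sum_(m : {ffun 'I_n -> 'I_N})
    c [ffun i => m i : nat] * \prod_i y 0 i ^+ m i = psum c N y.
  rewrite /psum -big_cube; apply: eq_bigr => m _; congr (_ * _).
  by apply: eq_bigr => i _; rewrite ffunE.
split=> -[c [r [M [r0 M0 cM cf]]]]; exists c, r, M; split=> //.
- by move=> N; rewrite -wE.
- move=> y yr; have := cf (x + y).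
  have e i : (x + y) 0 i - x 0 i = y 0 i by rewrite mxE addrC addKr.
  under eq_fun do under eq_bigr do under eq_bigr do rewrite e.
  under eq_fun do rewrite pE.
  by apply=> i; rewrite e.
- by move=> N; rewrite wE.
- move=> y yr; have := cf (y - x); rewrite [x + _]addrC subrK.
  under eq_fun do rewrite -pE.
  under eq_fun do under eq_bigr do under eq_bigr do rewrite !mxE.
  by apply=> i; rewrite !mxE.
Qed.

Lemma nbhs_polydisc x (P : set 'rV[C]_n) : nbhs x P ->
  exists2 r : C, 0 < r & forall y, (forall i, `|y 0 i| < r) -> P (x + y).
Proof.
move=> /nbhs_ballP[r /= r0 rP]; exists r => // y yr; apply: rP => /=.
split=> // i j; rewrite ord1 /ball/= mxE opprD addNKr normrN.
exact: yr.
Qed.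

Lemma min_radius (r s : C) : 0 < r -> 0 < s ->
  exists t : C, [/\ 0 < t, t <= r & t <= s].
Proof.
move=> r0 s0; have [rs|sr] := real_leP (gtr0_real r0) (gtr0_real s0).
  by exists r.
by exists s; split=> //; exact: ltW.
Qed.

Lemma near_analytic_at f g x : (\forall y \near x, f y = g y) ->
  analytic_at f x -> analytic_at g x.
Proof.
move=> /nbhs_polydisc[s s0 sfg] /analytic_atP[c [r [M [r0 M0 cM cf]]]].
have [t [t0 tr ts]] := min_radius r0 s0.
apply/analytic_atP; exists c, t, M; split=> //.
  by move=> N; apply: wsum_le (cM N) => //; exact: ltW.
move=> y yt; rewrite -sfg; last by move=> i; exact: lt_le_trans (yt i) ts.
by apply: cf => i; exact: lt_le_trans (yt i) tr.
Qed.

Lemma eq_analytic_at f g x : f =1 g -> analytic_at f x -> analytic_at g x.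
Proof. by move=> /funext ->. Qed.

Lemma analytic_cst (a : C) x : analytic_at (fun=> a) x.
Proof.
apply/analytic_atP; exists (fun m => if m == 0 then a else 0), 1, `|a|; split=> //.
- move=> N; rewrite /wsum (eq_bigr (fun m => if m == 0 then `|a| else 0)).
    rewrite -big_mkcond/= big_const_seq iter_addr_0.
    rewrite (@eq_count _ _ (pred1 0))// count_uniq_mem ?cube_uniq//.
    by case: (_ \in _); rewrite ?mulr0n.
  by move=> m _; case: eqP => _; rewrite ?normr0 ?mul0r// expr1n mulr1.
- move=> y _; apply: cvg_near_cst; exists 1%N => // N /= N0; rewrite /psum.
  rewrite (eq_bigr (fun m => if m == 0 then a else 0)).
    rewrite -big_mkcond/= big_const_seq iter_addr_0.
    rewrite (@eq_count _ _ (pred1 0))// count_uniq_mem ?cube_uniq//.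
    suff -> : (0 : mi) \in cube n N by [].
    by rewrite mem_cube; apply/forallP => i; rewrite ffunE.
  by move=> m _; case: eqP => [->|_]; rewrite ?mul0r// mpow0 mulr1.
Qed.

Lemma analyticD f g x : analytic_at f x -> analytic_at g x ->
  analytic_at (fun y => f y + g y) x.
Proof.
move=> /analytic_atP[c [r [M [r0 M0 cM cf]]]].
move=> /analytic_atP[b [s [M' [s0 M'0 bM bg]]]].
have [t [t0 tr ts]] := min_radius r0 s0.
apply/analytic_atP; exists (fun m => c m + b m), t, (M + M'); split=> //.
- exact: addr_ge0.
- move=> N; apply: (@le_trans _ _ (wsum c N t + wsum b N t)).
    rewrite /wsum -big_split/=; apply: ler_sum => m _.
    by rewrite -mulrDl ler_wpM2r ?exprn_ge0 ?ler_normD// ltW.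
  by apply: lerD; [apply: wsum_le (cM N)|apply: wsum_le (bM N)] => //; exact: ltW.
- move=> y yt; rewrite (_ : (fun N => _) = (fun N => psum c N y + psum b N y)).
    by apply: (cvgD (cf y _) (bg y _)) => i; apply: lt_le_trans (yt i) _.
  apply/funext => N; rewrite /psum -big_split/=; apply: eq_bigr => m _.
  by rewrite mulrDl.
Qed.

(** Cauchy products converge to products. *)
Lemma psum_conv_cvg c b (r M M' : C) y : 0 < r -> 0 <= M -> 0 <= M' ->
  (forall N, wsum c N r <= M) -> (forall N, wsum b N r <= M') ->
  (forall i, `|y 0 i| < r) ->
  (fun N => psum c N y * psum b N y - psum (conv c b) N y) @ \oo --> (0 : C).
Proof.
move=> r0 M0 M'0 cM bM yr; have [t [t0 t1 yt]] := polydisc_contract r0 yr.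
have tc : (fun N : nat => t ^+ N * (M * M')) @ \oo --> (0 : C).
  by apply: cvg_geometricM; rewrite t0.
apply/cvgrPdist_lt => e e0; move/cvgrPdist_lt/(_ e e0) : tc.
apply: filterS => N; rewrite !sub0r !normrN ger0_norm; last first.
  by rewrite !mulr_ge0// exprn_ge0.
apply: le_lt_trans; apply: (psum_conv_le _ _ M0 M'0 (cM N) (bM N) yt).
  exact: ltW.
by rewrite t0 ltW.
Qed.

Lemma analyticM f g x : analytic_at f x -> analytic_at g x ->
  analytic_at (fun y => f y * g y) x.
Proof.
move=> /analytic_atP[c [r [M [r0 M0 cM cf]]]].
move=> /analytic_atP[b [s [M' [s0 M'0 bM bg]]]].
have [t [t0 tr ts]] := min_radius r0 s0.
have cM' N : wsum c N t <= M by apply: wsum_le (cM N) => //; exact: ltW.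
have bM' N : wsum b N t <= M' by apply: wsum_le (bM N) => //; exact: ltW.
apply/analytic_atP; exists (conv c b), t, (M * M'); split=> //.
- exact: mulr_ge0.
- move=> N; apply: (le_trans (wsum_conv _ _ _ (ltW t0))).
  by rewrite ler_pM// wsum_ge0// ltW.
- move=> y yt.
  have cf' : (fun N => psum c N y) @ \oo --> f (x + y).
    by apply: cf => i; exact: lt_le_trans (yt i) tr.
  have bg' : (fun N => psum b N y) @ \oo --> g (x + y).
    by apply: bg => i; exact: lt_le_trans (yt i) ts.
  have : (fun N => psum c N y * psum b N y -
      (psum c N y * psum b N y - psum (conv c b) N y)) @ \oo -->
      f (x + y) * g (x + y) - 0.
    exact: cvgB (cvgM cf' bg') (psum_conv_cvg t0 M0 M'0 cM' bM' yt).
  rewrite subr0 => cbfg; apply: (near_eq_seq (N0 := 0)) cbfg => N _ /=.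
  by rewrite opprB addrC subrK.
Qed.

Lemma psum_cvg c (r M : C) y : 0 < r -> (forall N, wsum c N r <= M) ->
  (forall i, `|y 0 i| < r) -> exists l : C, (fun N => psum c N y) @ \oo --> l.
Proof.
move=> r0 cM yr; have [t [t0 t1 yt]] := polydisc_contract r0 yr.
have tc : (fun N : nat => t ^+ N * M) @ \oo --> (0 : C).
  by apply: cvg_geometricM; rewrite t0.
apply: Cplx_cauchy => e e0; move/cvgrPdist_lt/(_ e e0) : tc => [N _ tN].
exists N => N' NN'; have := tN N (leqnn N); rewrite /= sub0r normrN.
have M0 : 0 <= M by apply: le_trans (cM 0%N); rewrite wsum_ge0// ltW.
rewrite ger0_norm ?mulr_ge0// ?exprn_ge0//; apply: le_lt_trans.
by apply: psumB_le (cM N') yt => //; [exact: ltW|rewrite t0 ltW].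
Qed.

Lemma analytic_psum_at0 f x c (r : C) : 0 < r ->
  (forall y, (forall i, `|y 0 i| < r) -> (fun N => psum c N y) @ \oo --> f (x + y)) ->
  f x = c 0.
Proof.
move=> r0 cf; have {}cf : (fun N => psum c N 0) @ \oo --> f x.
  by rewrite -[x]addr0; apply: cf => i; rewrite mxE normr0.
apply: (seq_cvg_unique cf); apply: cvg_near_cst.
by exists 1%N => // -[//|N] _; rewrite psum_at0.
Qed.

(** The formal inverse b of the series of f has a bounded sum of moduli on a small
polydisc, hence converges there; its sum is the inverse of f since the product of
the two series is the constant 1. *)
Lemma analyticV f x : f x != 0 -> analytic_at f x ->
  analytic_at (fun y => (f y)^-1) x.
Proof.
move=> fx0 /analytic_atP[c [r [M [r0 M0 cM cf]]]].
have c0 : c 0 != 0 by rewrite -(analytic_psum_at0 r0 cf).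
have [b cb] := conv_inverse c0.
have nc0 : 0 < `|c 0| by rewrite normr_gt0.
(* shrinking the radius by e bounds the non-constant part of c by e * M, and e is
   such that e * M <= |c 0| / 2 *)
have d0 : 0 < 2 * M + `|c 0| by rewrite ltr_wpDl// mulr_ge0.
pose e := `|c 0| / (2 * M + `|c 0|).
have e0 : 0 < e by rewrite divr_gt0.
have e1 : e <= 1 by rewrite ler_pdivrMr// mul1r lerDr mulr_ge0.
have eM : e * M <= `|c 0| / 2.
  rewrite /e mulrAC -mulrA ler_wpM2l// ler_pdivrMr// mulrDr mulrA.
  by rewrite mulVf ?pnatr_eq0// mul1r lerDl mulr_ge0.
have er0 : 0 < e * r by rewrite mulr_gt0.
have err : e * r <= r by rewrite ger_pMl.
have cM' N : wsum c N (e * r) <= M by apply: wsum_le (cM N) => //; exact: ltW.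
have bM N : wsum b N (e * r) <= 2 / `|c 0|.
  apply: (wsum_inverse (ltW er0) c0 cb); apply: le_trans eM.
  apply: (@le_trans _ _ (e * wsum c N r)); last by rewrite ler_wpM2l// ltW.
  rewrite /wsum mulr_sumr; apply: ler_sum => m _; have [->|m0] := eqVneq m 0.
    rewrite normr0 mul0r; apply: mulr_ge0 (ltW e0) _.
    by apply: mulr_ge0 => //; exact: exprn_ge0 (ltW r0).
  rewrite mulrCA ler_wpM2l// exprMn ler_wpM2r ?exprn_ge0 ?(ltW r0)//.
  by rewrite -[leRHS]expr1 ler_wiXn2l// ?(ltW e0)// lt0n mdeg_eq0.
have b0 : 0 <= 2 / `|c 0| by rewrite divr_ge0// ltW.
apply/analytic_atP; exists b, (e * r), (2 / `|c 0|); split=> // y yr.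
have yr' i : `|y 0 i| < r by exact: lt_le_trans (yr i) err.
have [l bl] := psum_cvg er0 bM yr.
have cb1 : (fun N => psum c N y * psum b N y - psum (conv c b) N y + 1) @ \oo
    --> (0 + 1 : C).
  exact: cvgD (psum_conv_cvg er0 M0 b0 cM' bM yr) (cvg_cst _).
rewrite add0r in cb1.
have fl : f (x + y) * l = 1.
  apply: (seq_cvg_unique (cvgM (cf y yr') bl)).
  apply: (near_eq_seq (N0 := 1)) cb1 => -[//|N] _ /=.
  suff -> : psum (conv c b) N.+1 y = 1 by rewrite subrK.
  have -> : (1 : C) = psum (conv c b) N.+1 0 by rewrite psum_at0 cb eqxx.
  apply: eq_bigr => m _; rewrite cb mpow_at0.
  by case: eqP => [->|_]; rewrite ?mul0r// mpow0.
have fxy0 : f (x + y) != 0.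
  by apply: contra_eqN fl => /eqP ->; rewrite mul0r eq_sym oner_eq0.
suff -> : (f (x + y))^-1 = l by [].
by rewrite -[LHS]mulr1 -fl mulKf.
Qed.

Lemma analyticN f x : analytic_at f x -> analytic_at (fun y => - f y) x.
Proof.
move=> fx; rewrite (_ : (fun y => _) = (fun y => -1 * f y)).
  exact: (analyticM (analytic_cst (-1) x) fx).
by apply/funext => y; rewrite mulN1r.
Qed.

Lemma analytic_sum (I : Type) (s : seq I) (P : pred I) (F : I -> 'rV[C]_n -> C) x :
  (forall i, P i -> analytic_at (F i) x) ->
  analytic_at (fun y => \sum_(i <- s | P i) F i y) x.
Proof.
move=> Fx; elim: s => [|i s IH].
  rewrite (_ : (fun y => _) = fun=> 0); first exact: (analytic_cst 0 x).
  by apply/funext => y; rewrite big_nil.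
have [Pi|Pi] := boolP (P i); last first.
  rewrite (_ : (fun y => _) = (fun y => \sum_(j <- s | P j) F j y)) //.
  by apply/funext => y; rewrite big_cons (negPf Pi).
pose G y : C := \sum_(j <- s | P j) F j y.
apply: (eq_analytic_at _ (@analyticD (F i) G x (Fx i Pi) IH)) => y.
by rewrite big_cons Pi.
Qed.

Lemma analytic_prod (I : Type) (s : seq I) (P : pred I) (F : I -> 'rV[C]_n -> C) x :
  (forall i, P i -> analytic_at (F i) x) ->
  analytic_at (fun y => \prod_(i <- s | P i) F i y) x.
Proof.
move=> Fx; elim: s => [|i s IH].
  rewrite (_ : (fun y => _) = fun=> 1); first exact: (analytic_cst 1 x).
  by apply/funext => y; rewrite big_nil.
have [Pi|Pi] := boolP (P i); last first.
  rewrite (_ : (fun y => _) = (fun y => \prod_(j <- s | P j) F j y)) //.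
  by apply/funext => y; rewrite big_cons (negPf Pi).
pose G y : C := \prod_(j <- s | P j) F j y.
apply: (eq_analytic_at _ (@analyticM (F i) G x (Fx i Pi) IH)) => y.
by rewrite big_cons Pi.
Qed.

Lemma analyticX f k x : analytic_at f x -> analytic_at (fun y => f y ^+ k) x.
Proof.
move=> fx; elim: k => [|k IH]; first exact: (analytic_cst 1 x).
apply: (eq_analytic_at _ (@analyticM f (fun y => f y ^+ k) x fx IH)) => y.
by rewrite exprS.
Qed.

End AnalyticFunctions.

(** * Partial derivatives of analytic functions *)

(** A quadratic remainder is a little o. *)
Lemma diff_quadratic (K : numFieldType) (V W : normedModType K) (f : V -> W)
    (df : {linear V -> W}) (x : V) (s B : K) : 0 < s -> 0 <= B -> continuous df ->
  (forall h, `|h| <= s -> `|f (x + h) - f x - df h| <= B * `|h| ^+ 2) ->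
  differentiable f x /\ 'd f x = df :> (V -> W).
Proof.
move=> s0 B0 dfc fG.
have fE : f \o shift x = cst (f x) + df +o_ 0 id.
  apply/eqaddoP => e e0.
  have d0 : 0 < e / (B + 1) by rewrite divr_gt0// ltr_wpDl.
  near=> h.
  have hs : `|h| <= s by near: h; exact: nbhs0_le.
  have he : `|h| <= e / (B + 1) by near: h; exact: nbhs0_le.
  rewrite [X in `|X| <= _](_ : _ = f (x + h) - f x - df h); last first.
    by rewrite /= [x + h]addrC -addrA -opprD.
  apply: (le_trans (fG h hs)); rewrite expr2 mulrA ler_wpM2r//.
  apply: (@le_trans _ _ ((B + 1) * `|h|)); first by rewrite ler_wpM2r// lerDl.
  by rewrite mulrC -ler_pdivlMr// ltr_wpDl.
have dE := diff_unique dfc fE.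
by split=> //; apply/diff_locallyP; rewrite dE.
Unshelve. all: by end_near. Qed.

Section AnalyticDerivative.
Variables (R : realType) (n : nat).
Local Notation C := (Cplx R).
Local Notation mi := {ffun 'I_n -> nat}.
Implicit Types (c b : mi -> C) (f g : 'rV[C]_n -> C) (x y h : 'rV[C]_n).

(** The candidate for the differential with partial derivatives G. *)
Definition linear_form (G : 'I_n -> C) h : C := \sum_j h 0 j * G j.

Lemma linear_form_is_linear G : linear (linear_form G).
Proof.
move=> a h h'; rewrite /linear_form scaler_sumr -big_split/=.
by apply: eq_bigr => j _; rewrite !mxE mulrDl -mulrA.
Qed.

HB.instance Definition _ G := GRing.isLinear.Build C 'rV[C]_n C _
  (linear_form G) (linear_form_is_linear G).

Lemma norm_coord_le h i : `|h 0 i| <= `|h|.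
Proof.
rewrite [leRHS]/Num.norm/= mx_normE -[leLHS]nngE num_le.
exact: (le_bigmax _ (fun ij => `|h ij.1 ij.2|%:nng) (0, i)).
Qed.

Lemma continuous_linear_form G : continuous (linear_form G).
Proof.
apply: continuous_big => [|j _ x]; first exact: add_continuous.
apply: (@cvgM _ _ (nbhs x) _ (fun h : 'rV[C]_n => h 0 j) (fun=> G j)).
  exact: (@coord_continuous C 1 n 0 j x).
exact: cvg_cst.
Qed.

Lemma derive_coord j x h : 'D_h (fun y : 'rV[C]_n => y 0 j) x = h 0 j.
Proof.
pose G i : C := (i == j)%:R.
have GE y : y 0 j = linear_form G y.
  rewrite /linear_form (bigD1 j)//= /G eqxx mulr1 big1 ?addr0// => i /negPf ij.
  by rewrite ij mulr0.
have [||df dE] := @diff_quadratic C 'rV[C]_n C (fun y => y 0 j) (linear_form G) x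
  1 0 ltr01 (lexx 0).
- exact: continuous_linear_form.
- move=> h' _; rewrite [X in `|X| <= _](_ : _ = 0) ?normr0 ?mul0r//.
  by rewrite mxE [X in X - _]addrAC subrr add0r GE; exact: subrr.
by rewrite (deriveE _ df) dE GE.
Qed.

Definition power_series_at f x c : Prop :=
  exists r M : C, [/\ 0 < r, 0 <= M, forall N, wsum c N r <= M &
    forall y, (forall i, `|y 0 i| < r) ->
      (fun N => psum c N y) @ \oo --> f (x + y)].

Lemma power_series_value f x c : power_series_at f x c -> f x = c 0.
Proof. by move=> [r [M [r0 _ _ cf]]]; exact: analytic_psum_at0 cf. Qed.

(** The Taylor bound of the partial sums passes to the limit. *)
Lemma psum_diff f x y c (s theta M : C) (G : 'I_n -> C) :
  0 < s -> 0 <= M -> (forall N, wsum c N (2 * s) <= M) ->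
  (forall z : 'rV[C]_n, (forall i, `|z 0 i| < 2 * s) ->
    (fun N => psum c N z) @ \oo --> f (x + z)) ->
  0 <= theta < 1 -> (forall i, `|y 0 i| <= theta * s) ->
  (forall j, (fun N => psum (dcoef j c) N y) @ \oo --> G j) ->
  differentiable f (x + y) /\ 'd f (x + y) = linear_form G :> ('rV[C]_n -> C).
Proof.
move=> s0 M0 cM cf t01 yt cG; have /andP[t0 t1] := t01.
have ys i : `|y 0 i| < s by apply: (le_lt_trans (yt i)); rewrite gtr_pMl.
apply: (@diff_quadratic _ _ _ f (linear_form G) _ s (M / s ^+ 2)) => // [||h hs].
- by rewrite divr_ge0// exprn_ge0// ltW.
- exact: continuous_linear_form.
have yh i : `|(y + h) 0 i| < 2 * s.
  rewrite mxE mulr_natl mulr2n (le_lt_trans (ler_normD _ _))// ltr_leD//.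
  exact: le_trans (norm_coord_le h i) hs.
have y2 i : `|y 0 i| < 2 * s.
  by apply: (lt_le_trans (ys i)); rewrite ler_peMl ?ler1n// ltW.
have lG : (fun N => \sum_j h 0 j * psum (dcoef j c) N y) @ \oo --> linear_form G h.
  apply: cvg_big => [|j _]; first exact: add_continuous.
  by apply: cvgM; [exact: cvg_cst|exact: cG].
have ul : (fun N => psum c N (y + h) - psum c N y -
      \sum_j h 0 j * psum (dcoef j c) N y) @ \oo -->
    f (x + (y + h)) - f (x + y) - linear_form G h.
  exact: cvgB (cvgB (cf _ yh) (cf _ y2)) lG.
have vl : (fun N => (`|h| / s) ^+ 2 * M +
    \sum_(j < n) `|h| * (theta ^+ N.-1 * (M / s))) @ \oo -->
    (`|h| / s) ^+ 2 * M + \sum_(j < n) `|h| * 0.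
  apply: cvgD; first exact: cvg_cst.
  apply: cvg_big => [|j _]; first exact: add_continuous.
  apply: cvgM; first exact: cvg_cst.
  rewrite -(cvg_shiftS (fun N => theta ^+ N.-1 * (M / s))).
  exact: cvg_geometricM.
have -> : M / s ^+ 2 * `|h| ^+ 2 = (`|h| / s) ^+ 2 * M + \sum_(j < n) `|h| * 0.
  rewrite big1 ?addr0; last by move=> j _; rewrite mulr0.
  by rewrite expr_div_n mulrC mulrA mulrAC.
rewrite -(addrA x); apply: (cvg_norm_le ul vl) => N.
apply: psum_taylor_le => //; first by rewrite normr_ge0.
  by rewrite t0 ltW.
exact: norm_coord_le.
Qed.

(** Differentiation term by term, on half the polydisc. *)
Lemma power_series_diff f x c : power_series_at f x c ->
  exists s M : C, [/\ 0 < s, 0 <= M, forall j N, wsum (dcoef j c) N s <= M &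
    forall y, (forall i, `|y 0 i| < s) -> exists G : 'I_n -> C,
      [/\ forall j, (fun N => psum (dcoef j c) N y) @ \oo --> G j,
          differentiable f (x + y) &
          'd f (x + y) = linear_form G :> ('rV[C]_n -> C)]].
Proof.
move=> [r [M [r0 M0 cM cf]]]; pose s := r / 2.
have s0 : 0 < s by rewrite divr_gt0.
have r2 : r = 2 * s by rewrite mulrC divfK// pnatr_eq0.
rewrite r2 in cM cf; exists s, (M / s); split=> //.
- by rewrite divr_ge0// ltW.
- by move=> j N; exact: wsum_dcoef.
move=> y ys; have [t [t0 t1 yt]] := polydisc_contract s0 ys.
have /choice[G cG] j : exists l : C, (fun N => psum (dcoef j c) N y) @ \oo --> l.
  by apply: (@psum_cvg _ _ _ s (M / s)) => // N; exact: wsum_dcoef.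
exists G; have [|df dE] := psum_diff s0 M0 cM cf _ yt cG; first by rewrite t0.
by split.
Qed.

Lemma linear_form_delta (G : 'I_n -> C) j : linear_form G (delta_mx 0 j) = G j.
Proof.
rewrite /linear_form (bigD1 j)//= mxE !eqxx mul1r big1 ?addr0// => i ij.
by rewrite mxE (negPf ij) andbF mul0r.
Qed.

Lemma power_series_derive f x c j : power_series_at f x c ->
  power_series_at (fun y => 'D_(delta_mx 0 j) f y) x (dcoef j c).
Proof.
move=> /power_series_diff[s [M [s0 M0 cM cf]]]; exists s, M; split=> // y ys.
have [G [cG df dE]] := cf y ys.
have -> : 'D_(delta_mx 0 j) f (x + y) = G j.
  by rewrite (deriveE _ df) dE linear_form_delta.
exact: cG.
Qed.

Lemma analytic_power_series f x :
  analytic_at f x <-> exists c, power_series_at f x c.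
Proof. exact: analytic_atP. Qed.

Lemma analytic_derive f x j : analytic_at f x ->
  analytic_at (fun y => 'D_(delta_mx 0 j) f y) x.
Proof.
move=> /analytic_power_series[c fc]; apply/analytic_power_series.
by exists (dcoef j c); exact: power_series_derive.
Qed.

Lemma analytic_differentiable f x : analytic_at f x -> differentiable f x.
Proof.
move=> /analytic_power_series[c /power_series_diff[s [M [s0 _ _ cf]]]].
have [|G [_ df _]] := cf 0; first by move=> i; rewrite mxE normr0.
by rewrite -[x]addr0.
Qed.

Lemma analytic_schwarz f x i j : analytic_at f x ->
  'D_(delta_mx 0 i) (fun y => 'D_(delta_mx 0 j) f y) x =
  'D_(delta_mx 0 j) (fun y => 'D_(delta_mx 0 i) f y) x.
Proof.
move=> /analytic_power_series[c fc].
pose D k := fun y => 'D_(delta_mx 0 k) f y.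
have Dc k l : 'D_(delta_mx 0 k) (D l) x = dcoef k (dcoef l c) 0.
  pose DD := fun y => 'D_(delta_mx 0 k) (D l) y.
  have fl : power_series_at (D l) x (dcoef l c) := power_series_derive l fc.
  have fkl : power_series_at DD x (dcoef k (dcoef l c)) :=
    power_series_derive k fl.
  exact: (power_series_value fkl).
by apply: etrans (Dc i j) (etrans (dcoefC _ _ _ _) (esym (Dc j i))).
Qed.

End AnalyticDerivative.

(** * The discriminant as a function of the coefficients *)

Lemma coef_pres_poly (A : comNzRingType) (d : nat) (b : 'I_d.+1 -> A) (k : 'I_d.+1) :
  (pres_poly b)`_(d - k) = b k.
Proof.
rewrite /pres_poly coef_sum (bigD1 k)//= coefZ coefXn eqxx mulr1.
rewrite big1 ?addr0// => i ik; rewrite coefZ coefXn.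
case: eqP => [e|_]; last by rewrite mulr0.
case/eqP: ik; apply/val_inj => /=.
by rewrite -(subKn (leq_ord i)) -e subKn// leq_ord.
Qed.

Section RootDiscriminant.
Variables (K : fieldType) (d : nat).
Implicit Types (cs : d.-tuple K) (b : 'I_d.+1 -> K).

Definition square_differences (s : seq K) : K :=
  \prod_(i < d) \prod_(j < d | (i < j)%N) (s`_i - s`_j) ^+ 2.

Let mX (i : 'I_d) : mpoly.mpoly d K := mpoly.mpolyX K (mpoly.mnm1 i).

(** A permutation of the variables permutes the columns of the Vandermonde matrix, so
it only changes the sign of its determinant. *)
Lemma Vandermonde_sqr_symmetric :
  (\det (Vandermonde d (\row_i mX i))) ^+ 2 \is mpoly.symmetric.
Proof.
apply/mpoly.issymP => s; rewrite rmorphXn /= -det_map_mx.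
have -> : map_mx (mpoly.msym s) (Vandermonde d (\row_i mX i)) =
    col_perm s (Vandermonde d (\row_i mX i)).
  apply/matrixP => k j; rewrite !mxE rmorphXn /=; congr (_ ^+ _).
  by rewrite /mpoly.msym mpoly.mmapX mpoly.mmap1U.
by rewrite col_permE det_mulmx exprMn det_perm sqrr_sign mulr1.
Qed.

(** The squared Vandermonde determinant is a symmetric polynomial in the roots,
hence a polynomial in their elementary symmetric functions. *)
Lemma square_differences_coef : exists t : mpoly.mpoly d K, forall cs,
  square_differences cs = mpoly.meval (fun k : 'I_d =>
    (-1) ^+ k.+1 * (\prod_(c <- cs) ('X - c%:P))`_(d - k.+1)) t.
Proof.
have [t [tE _]] := mpoly.sym_fundamental Vandermonde_sqr_symmetric.
exists t => cs; transitivity (mpoly.meval (tnth cs)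
    ((\det (Vandermonde d (\row_i mX i))) ^+ 2)).
  rewrite rmorphXn /= det_Vandermonde rmorph_prod -prodrXl; apply: eq_bigr => i _.
  rewrite rmorph_prod -prodrXl; apply: eq_bigr => j _.
  by rewrite !mxE rmorphB/= !mpoly.mevalXU -sqrrN opprB !(tnth_nth 0).
rewrite -tE mpoly.comp_mpoly_meval; apply: mpoly.meval_eq => k.
have := mpoly.mroots_coeff cs (lift ord0 k); rewrite /= /bump/= add1n => ->.
by rewrite signrMK tnth_map tnth_ord_tuple.
Qed.

Lemma size_pres_poly b : (size (pres_poly b) <= d.+1)%N.
Proof.
apply: (leq_trans (size_sum _ _ _)); apply/bigmax_leqP => i _; rewrite (leq_trans (size_scale_leq _ _))//.
by rewrite size_polyXn ltnS leq_subr.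
Qed.

Lemma size_pres_poly_eq b : b ord0 != 0 -> size (pres_poly b) = d.+1.
Proof.
move=> b0; apply/eqP; rewrite eqn_leq size_pres_poly ltnNge.
by apply: contra b0 => /leq_sizeP/(_ d (leqnn d)); rewrite -[X in _`_X]subn0
  (coef_pres_poly b ord0) => ->.
Qed.

Lemma lead_coef_pres_poly b : b ord0 != 0 -> lead_coef (pres_poly b) = b ord0.
Proof.
by move=> b0; rewrite lead_coefE size_pres_poly_eq// -(coef_pres_poly b ord0) subn0.
Qed.

Lemma coef_roots b cs (k : 'I_d.+1) : b ord0 != 0 ->
  pres_poly b = b ord0 *: \prod_(c <- cs) ('X - c%:P) ->
  (\prod_(c <- cs) ('X - c%:P))`_(d - k) = b k / b ord0.
Proof.
by move=> b0 bE; rewrite -(coef_pres_poly b k) bE coefZ mulrC mulKf.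
Qed.

End RootDiscriminant.

Section RootsSeq.
Variables (K : numClosedFieldType) (d : nat) (b : 'I_d.+1 -> K).
Hypothesis b0 : b ord0 != 0.

Lemma roots_seqP : exists2 cs : d.-tuple K, roots_seq (pres_poly b) = cs &
  pres_poly b = b ord0 *: \prod_(c <- cs) ('X - c%:P).
Proof.
have := svalP (closed_field_poly_normal (pres_poly b)).
rewrite -/(roots_seq _) lead_coef_pres_poly// => bE.
have sz : size (roots_seq (pres_poly b)) == d.
  have := size_pres_poly_eq b0.
  by rewrite {1}bE size_scale// size_prod_XsubC => -[->].
by exists (Tuple sz).
Qed.

End RootsSeq.

(** * The discriminant under homographies *)

Section PairProducts.
Variables (K : fieldType) (d : nat).

(** Each index belongs to d - 1 pairs. *)
Lemma prod_pairs (n : 'I_d -> K) :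
  \prod_(i < d) \prod_(j < d | (i < j)%N) (n i * n j) = (\prod_i n i) ^+ d.-1.
Proof.
rewrite (eq_bigr (fun i : 'I_d => (\prod_(j < d | (i < j)%N) n i) *
  \prod_(j < d | (i < j)%N) n j)); last by move=> i _; rewrite big_split.
rewrite big_split/= [X in _ * X](exchange_big_dep xpredT)//= -big_split/=.
rewrite -prodrXl; apply: eq_bigr => i _; rewrite !prodr_const -exprD.
congr (_ ^+ _).
have := cardC1 i; rewrite card_ord => <-.
rewrite -[X in (X + _)%N]/#|[pred j : 'I_d | (i < j)%N]|.
rewrite -[X in (_ + X)%N]/#|[pred j : 'I_d | (j < i)%N]| -cardUI.
rewrite [X in (_ + X)%N]eq_card0 ?addn0; last first.
  by move=> j; rewrite !inE; case: ltngtP.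
by apply: eq_card => j; rewrite !inE orbC -neq_ltn.
Qed.

(** The homography z |-> (c + e z) / (a + b z) multiplies each difference of two
points by the determinant, up to the denominators at these points. *)
Lemma square_differences_homography (a b c e : K) (p p' : d.-tuple K) :
  (forall i, a + b * tnth p i != 0) ->
  (forall i, tnth p' i = (c + e * tnth p i) / (a + b * tnth p i)) ->
  square_differences d p' * (\prod_i (a + b * tnth p i)) ^+ (2 * d.-1) =
  (a * e - b * c) ^+ (d * d.-1) * square_differences d p.
Proof.
move=> n0 p'E; set D := a * e - b * c.
have -> : D ^+ (d * d.-1) = (\prod_(i < d) D) ^+ d.-1.
  by rewrite prodr_const card_ord exprM.
rewrite mulnC exprM -!prod_pairs /square_differences -prodrXl -!big_split/=.
apply: eq_bigr => i _; rewrite -prodrXl -!big_split/=; apply: eq_bigr => j _.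
rewrite -!(tnth_nth 0) !p'E /D; have ni := n0 i; have nj := n0 j.
by field; rewrite ni nj.
Qed.

End PairProducts.

(** * The discriminant of a web *)

Section RegularLocus.
Variables (R : realType) (d : nat).
Local Notation C := (Cplx R).
Variable a : 'I_d.+1 -> 'rV[C]_2 -> C.
Implicit Type q : 'rV[C]_2.

Definition eval_at q (f : 'rV[C]_2 -> C) : C := f q.

Lemma eval_at_is_additive q : additive (eval_at q).
Proof. by []. Qed.

Lemma eval_at_is_multiplicative q : multiplicative (eval_at q).
Proof. by []. Qed.

HB.instance Definition _ q := GRing.isAdditive.Build ('rV[C]_2 -> C) C
  (eval_at q) (eval_at_is_additive q).
HB.instance Definition _ q := GRing.isMultiplicative.Build ('rV[C]_2 -> C) C
  (eval_at q) (eval_at_is_multiplicative q).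

Lemma map_pres_poly q : map_poly (eval_at q) (pres_poly a) = pres_at a q.
Proof.
rewrite /pres_poly raddf_sum; apply: eq_bigr => i _ /=.
by rewrite map_polyZ/= map_polyXn.
Qed.

(** Evaluated at q, the resultant is a combination of the presentation polynomial
and its derivative, so these have no common root where it does not vanish. *)
Lemma pres_at_coprime q : (1 < d)%N -> a ord0 q != 0 -> web_resultant a q != 0 ->
  coprimep (pres_at a q) (pres_at a q)^`().
Proof.
move=> d1 a0 res0.
have szd (p : {poly 'rV[C]_2 -> C}) k : eval_at q p`_k != 0 -> (k < size p)%N.
  by move=> pk; rewrite ltnNge; apply: contra pk => /leq_sizeP/(_ k (leqnn k)) ->.
have lead : (pres_poly a)`_d = a ord0.
  by have := coef_pres_poly a ord0; rewrite subn0.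
have P1 : (1 < size (pres_poly a))%N.
  by apply: (leq_trans d1); apply/ltnW/szd; rewrite lead.
have P'1 : (1 < size (pres_poly a)^`())%N.
  apply: leq_ltn_trans (szd _ d.-1 _); first by case: (d) d1 => [|[]].
  have -> : (pres_poly a)^`()`_d.-1 = a ord0 *+ d.
    by rewrite coef_deriv (prednK (ltnW d1)) lead.
  have -> : eval_at q (a ord0 *+ d) = a ord0 q *+ d by rewrite raddfMn.
  by rewrite mulrn_eq0 (negPf a0) orbF -lt0n ltnW.
have [[u v] _ /= uvE] := resultant_in_ideal P1 P'1.
apply/Bezout_coprimepP.
exists (map_poly (eval_at q) u, map_poly (eval_at q) v) => /=.
rewrite -map_pres_poly deriv_map -!rmorphM -rmorphD /= -uvE map_polyC/=.
by rewrite polyC_eqp1.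
Qed.

(** The case d = 1 is separate because the derivative is then a constant polynomial
and [resultant_in_ideal] does not apply. *)
Lemma uniq_roots_regular q (cs : d.-tuple C) :
  a ord0 q != 0 -> web_resultant a q != 0 ->
  pres_at a q = a ord0 q *: \prod_(c <- cs) ('X - c%:P) -> uniq cs.
Proof.
move=> a0 res0 PE; have [d1|d1] := leqP d 1.
  have : (size cs <= 1)%N by rewrite size_tuple.
  by case: (val cs) => [|? []].
have := pres_at_coprime d1 a0 res0.
rewrite PE derivZ coprimepZl// coprimepZr//.
by rewrite -separable_prod_XsubC separable_poly.unlock.
Qed.

Definition web_delta q : C := square_differences d (roots_seq (pres_at a q)).

Lemma web_discriminantE q :
  web_discriminant a q = a ord0 q ^+ (2 * d - 2) * web_delta q.
Proof. by []. Qed.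

(** The polynomial t does not depend on the point, and its value does not depend on
the order in which the roots are listed. *)
Lemma web_delta_coef : exists t : mpoly.mpoly d C, forall q, a ord0 q != 0 ->
  forall cs : d.-tuple C, pres_at a q = a ord0 q *: \prod_(c <- cs) ('X - c%:P) ->
  square_differences d cs = mpoly.meval (fun k : 'I_d =>
    (-1) ^+ k.+1 * (a (lift ord0 k) q / a ord0 q)) t.
Proof.
have [t tE] := square_differences_coef C d; exists t => q a0 cs PE; rewrite tE.
apply: mpoly.meval_eq => k; congr (_ * _).
by rewrite -(coef_roots (lift ord0 k) a0 PE).
Qed.

Lemma web_delta_roots q (cs : d.-tuple C) : a ord0 q != 0 ->
  pres_at a q = a ord0 q *: \prod_(c <- cs) ('X - c%:P) ->
  web_delta q = square_differences d cs.
Proof.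
move=> a0 PE; have [t tE] := web_delta_coef.
have [cs' rE PE'] := roots_seqP (b := a ^~ q) a0.
by rewrite /web_delta /pres_at rE (tE q a0 cs') ?(tE q a0 cs).
Qed.

Lemma near_neq0 (f : 'rV[C]_2 -> C) q : analytic_at f q -> f q != 0 ->
  \forall x \near q, f x != 0.
Proof.
move=> /analytic_differentiable/differentiable_continuous fc f0.
exact: (cvgr_neq0 (f q) fc f0).
Qed.

Lemma analytic_web_delta q : (forall i, analytic_at (a i) q) -> a ord0 q != 0 ->
  analytic_at web_delta q.
Proof.
move=> aq a0; have [t tE] := web_delta_coef.
pose g x := \sum_(m <- mpoly.msupp t) mpoly.mcoeff m t * \prod_(k : 'I_d)
  ((-1) ^+ k.+1 * (a (lift ord0 k) x * (a ord0 x)^-1)) ^+ m k.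
have gq : analytic_at g q.
  apply: analytic_sum => m _.
  apply: (@analyticM _ _ _ _ _ (analytic_cst _ _)); apply: analytic_prod => k _.
  apply: analyticX; apply: (@analyticM _ _ _ _ _ (analytic_cst _ _)).
  exact: (analyticM (aq _) (analyticV a0 (aq _))).
apply: near_analytic_at gq; apply: filterS (near_neq0 (aq ord0) a0) => x ax.
have [cs rE PE] := roots_seqP (b := a ^~ x) ax.
by rewrite (web_delta_roots ax PE) (tE x ax cs PE) mpoly.mevalE.
Qed.

Lemma analytic_web_discriminant q :
  (forall i, analytic_at (a i) q) -> a ord0 q != 0 ->
  analytic_at (web_discriminant a) q.
Proof.
move=> aq a0.
exact: (analyticM (analyticX (2 * d - 2) (aq ord0)) (analytic_web_delta aq a0)).
Qed.

End RegularLocus.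

(** * Functions of time and space *)

Section PartialFunctions.
Variables (R : realType) (n : nat).
Local Notation C := (Cplx R).
Implicit Types (Psi : 'rV[C]_(1 + n) -> C) (t : C) (q w : 'rV[C]_n).

(** Time and space variables grouped in one vector, as in the definition of a web
symmetry. *)
Definition time_point t q : 'rV[C]_(1 + n) := row_mx t%:M q.

Let line_time Psi t q :
  (fun h : C => h^-1 *: (((fun s => Psi (time_point s q)) \o shift t) (h *: 1)
     - Psi (time_point t q))) =
  (fun h : C => h^-1 *: ((Psi \o shift (time_point t q))
     (h *: delta_mx 0 (lshift n 0)) - Psi (time_point t q))).
Proof.
apply/funext => h /=; congr (_ *: (Psi _ - _)).
apply/rowP => i; rewrite !mxE; case: (splitP i) => j ij.
  rewrite !ord1 !mxE (_ : i = lshift n 0) ?eqxx; last by apply/val_inj => /=; rewrite ij ord1.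
  by rewrite mulr1 [h *: _]mulr1.
rewrite (_ : (i == _) = false) ?andbF ?mulr0 ?add0r//.
by apply/negP => /eqP ei; move: ij; rewrite ei.
Qed.

Lemma derive_time Psi t q : 'D_1 (fun s => Psi (time_point s q)) t =
  'D_(delta_mx 0 (lshift n 0)) Psi (time_point t q).
Proof. by rewrite /derive line_time. Qed.

Lemma derivable_time Psi t q :
  derivable Psi (time_point t q) (delta_mx 0 (lshift n 0)) ->
  derivable (fun s => Psi (time_point s q)) t 1.
Proof. by rewrite /derivable line_time. Qed.

Let line_space Psi t q w :
  (fun h : C => h^-1 *: (((fun x => Psi (time_point t x)) \o shift q) (h *: w)
     - Psi (time_point t q))) =
  (fun h : C => h^-1 *: ((Psi \o shift (time_point t q))
     (h *: row_mx 0 w) - Psi (time_point t q))).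
Proof.
apply/funext => h /=; congr (_ *: (Psi _ - _)).
by rewrite scale_row_mx add_row_mx scaler0 add0r.
Qed.

Lemma derive_space Psi t q w : 'D_w (fun x => Psi (time_point t x)) q =
  'D_(row_mx 0 w) Psi (time_point t q).
Proof. by rewrite /derive line_space. Qed.

Lemma derivable_space Psi t q w :
  derivable Psi (time_point t q) (row_mx 0 w) ->
  derivable (fun x => Psi (time_point t x)) q w.
Proof. by rewrite /derivable line_space. Qed.

Lemma row_mx0_delta (k : 'I_n) :
  row_mx 0 (delta_mx 0 k) = delta_mx 0 (rshift 1 k) :> 'rV[C]_(1 + n).
Proof.
apply/rowP => i; rewrite !mxE; case: (splitP i) => j ij; rewrite !mxE.
  rewrite (_ : (i == _) = false) ?andbF//.
  by apply/negP => /eqP ei; move: ij; rewrite ei ord1.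
congr (_ && _)%:R; have -> : i = rshift 1 j by exact/val_inj.
by rewrite (inj_eq (@rshift_inj _ _)).
Qed.

Lemma cvg_rV (T : Type) (F : set_system T) {FF : Filter F} (m : nat)
    (f : T -> 'rV[C]_m) (l : 'rV[C]_m) :
  (forall j, (fun x => f x 0 j) @ F --> l 0 j) -> f @ F --> l.
Proof.
move=> fl; rewrite [l]row_sum_delta.
rewrite (_ : f = fun x => \sum_j f x 0 j *: delta_mx 0 j); last first.
  by apply/funext => x; exact: row_sum_delta.
apply: cvg_big => [|j _]; first exact: add_continuous.
exact: cvgZr_tmp.
Qed.

Lemma is_derive_rV (V : normedModType C) (m : nat) (f : V -> 'rV[C]_m) (x v : V) :
  (forall j, derivable (fun y => f y 0 j) x v) ->
  is_derive x v f (\row_j 'D_v (fun y => f y 0 j) x).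
Proof.
move=> fx.
have fl : (fun h : C => h^-1 *: ((f \o shift x) (h *: v) - f x)) @ 0^' -->
    \row_j 'D_v (fun y => f y 0 j) x.
  apply: cvg_rV => j; rewrite mxE.
  rewrite (_ : (fun h => _) = (fun h : C => h^-1 *: (((fun y => f y 0 j) \o shift x)
    (h *: v) - f x 0 j))); first exact: fx.
  by apply/funext => h; rewrite !mxE.
by split; [apply/cvg_ex; exists (\row_j 'D_v (fun y => f y 0 j) x)|exact/cvg_lim].
Qed.

End PartialFunctions.

(** * Derivatives of the flow *)

Section Flow.
Variables (R : realType).
Local Notation C := (Cplx R).
Variables (alpha1 alpha2 : 'rV[C]_2 -> C) (V : set 'rV[C]_2) (r : C).
Variables (phi : C -> 'rV[C]_2 -> 'rV[C]_2).
Hypotheses (openV : open V) (r_gt0 : 0 < r).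
Hypothesis phi_analytic : forall j, analytic_on
  [set u : 'rV[C]_(1 + 2) | `|lsubmx u 0 0| < r /\ V (rsubmx u)]
  (fun u => phi (lsubmx u 0 0) (rsubmx u) 0 j).
Hypothesis phi_id : forall q, V q -> phi 0 q = q.
Hypothesis phi_generator : forall q, V q ->
  'D_1 (fun t : C => phi t q) 0 = vec2 (alpha1 q) (alpha2 q).
Implicit Types (t : C) (q w : 'rV[C]_2) (j k : 'I_2).

Definition flow_coord j (u : 'rV[C]_(1 + 2)) : C :=
  phi (lsubmx u 0 0) (rsubmx u) 0 j.

(** Row j, column k of the Jacobian matrix at q of the flow at time t. It is taken as
a partial derivative of a function on time and space, so that it can be
differentiated in time. *)
Definition flow_jacobian q j k t : C :=
  'D_(delta_mx 0 (rshift 1 k)) (flow_coord j) (time_point t q).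

Lemma flow_coord_point j t q : flow_coord j (time_point t q) = phi t q 0 j.
Proof. by rewrite /flow_coord row_mxKl row_mxKr mxE eqxx mulr1n. Qed.

Lemma flow_coord_analytic j t q : `|t| < r -> V q ->
  analytic_at (flow_coord j) (time_point t q).
Proof.
move=> tr Vq; apply: phi_analytic; split; last by rewrite row_mxKr.
by rewrite row_mxKl mxE eqxx mulr1n.
Qed.

Let norm0r : `|0 : C| < r. Proof. by rewrite normr0. Qed.

Lemma vec2_delta (x y : C) :
  vec2 x y = x *: delta_mx 0 0 + y *: delta_mx 0 1 :> 'rV[C]_2.
Proof.
apply/rowP => j; rewrite !mxE !eqxx /=.
by case: j => -[|[|//]] j2 /=; rewrite ?mulr1 ?mulr0 ?addr0 ?add0r.
Qed.

Lemma derive_flow t q (z : C) : `|t| < r -> V q ->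
  'D_(vec2 1 z) (phi t) q =
  \row_j (flow_jacobian q j 0 t + flow_jacobian q j 1 t * z).
Proof.
move=> tr Vq.
have dPhi j : differentiable (flow_coord j) (time_point t q).
  by apply: analytic_differentiable; exact: flow_coord_analytic.
have phiE j : (fun y => phi t y 0 j) = (fun y => flow_coord j (time_point t y)).
  by apply/funext => y; rewrite flow_coord_point.
have dphi j : derivable (fun y => phi t y 0 j) q (vec2 1 z).
  by rewrite phiE; apply: derivable_space; exact: diff_derivable.
have [_ ->] := is_derive_rV dphi.
apply/rowP => j; rewrite !mxE phiE derive_space (deriveE _ (dPhi j)).
have -> : row_mx 0 (vec2 1 z) = delta_mx 0 (rshift 1 0) +
    z *: delta_mx 0 (rshift 1 1) :> 'rV[C]_(1 + 2).
  rewrite -!row_mx0_delta vec2_delta scale1r scale_row_mx add_row_mx.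
  by rewrite scaler0 addr0.
rewrite linearD linearZ /= /flow_jacobian !(deriveE _ (dPhi j)).
by rewrite [z *: _]mulrC.
Qed.

Lemma flow_jacobian0 q j k : V q -> flow_jacobian q j k 0 = (j == k)%:R.
Proof.
move=> Vq; rewrite /flow_jacobian -row_mx0_delta -derive_space.
have e : \forall y \near q, flow_coord j (time_point 0 y) = y 0 j.
  apply: filterS (open_nbhs_nbhs (conj openV Vq)) => y Vy.
  by rewrite flow_coord_point phi_id.
rewrite (near_eq_derive _ e).
by rewrite derive_coord mxE.
Qed.

Lemma flow_velocity q : V q ->
  is_derive (0 : C) 1 (fun t => phi t q) (vec2 (alpha1 q) (alpha2 q)).
Proof.
move=> Vq; rewrite -phi_generator//.
have dphi j : derivable (fun t => phi t q 0 j) 0 1.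
  rewrite (_ : (fun t => _) = (fun t => flow_coord j (time_point t q))).
    apply/derivable_time/diff_derivable/analytic_differentiable.
    exact: flow_coord_analytic.
  by apply/funext => t; rewrite flow_coord_point.
by have [dq _] := is_derive_rV dphi; exact: derivableP.
Qed.

Lemma flow_coord_velocity q j : V q ->
  'D_(delta_mx 0 (lshift 2 0)) (flow_coord j) (time_point 0 q) =
  vec2 (alpha1 q) (alpha2 q) 0 j.
Proof.
move=> Vq.
have phiE i : (fun t => phi t q 0 i) = (fun t => flow_coord i (time_point t q)).
  by apply/funext => t; rewrite flow_coord_point.
have dphi i : derivable (fun t => phi t q 0 i) 0 1.
  rewrite phiE; apply/derivable_time/diff_derivable/analytic_differentiable.
  exact: flow_coord_analytic.
have [_ /rowP/(_ j)] := is_derive_rV dphi.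
by rewrite phi_generator// [RHS]mxE => ->; rewrite -derive_time -phiE.
Qed.

(** The time derivatives of the space derivatives of the flow are the space derivatives
of its time derivative, by symmetry of second derivatives. *)
Lemma flow_jacobian_velocity q j k : V q ->
  is_derive (0 : C) 1 (flow_jacobian q j k)
    ('D_(delta_mx 0 k) (fun y => vec2 (alpha1 y) (alpha2 y) 0 j) q).
Proof.
move=> Vq; have Phi0 := flow_coord_analytic j norm0r Vq.
pose Psi u := 'D_(delta_mx 0 (rshift 1 k)) (flow_coord j) u.
have Psi0 : analytic_at Psi (time_point 0 q) by exact: (analytic_derive _ Phi0).
have dPsi : derivable (fun t => Psi (time_point t q)) 0 1.
  by apply/derivable_time/diff_derivable; exact: analytic_differentiable.
have -> : 'D_(delta_mx 0 k) (fun y => vec2 (alpha1 y) (alpha2 y) 0 j) q =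
    'D_1 (fun t => Psi (time_point t q)) 0.
  rewrite derive_time (analytic_schwarz _ _ Phi0) -row_mx0_delta -derive_space.
  apply/esym/near_eq_derive.
  apply: filterS (open_nbhs_nbhs (conj openV Vq)) => y Vy.
  exact: flow_coord_velocity.
exact: derivableP.
Qed.

End Flow.

(** * Derivative of the transformation rule *)

Section DerivativesAtOne.
Variable K : numFieldType.
Implicit Types (f g : K -> K) (I : Type).

Lemma is_derive_mul f g (df dg : K) :
  is_derive (0 : K) 1 f df -> is_derive (0 : K) 1 g dg ->
  is_derive (0 : K) 1 (fun t => f t * g t) (f 0 * dg + g 0 * df).
Proof. by move=> fd gd; exact: is_deriveM. Qed.

Lemma is_derive_add f g (df dg : K) :
  is_derive (0 : K) 1 f df -> is_derive (0 : K) 1 g dg ->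
  is_derive (0 : K) 1 (fun t => f t + g t) (df + dg).
Proof. by move=> fd gd; exact: is_deriveD. Qed.

Lemma is_derive_const (c : K) : is_derive (0 : K) 1 (fun=> c) 0.
Proof. exact: is_derive_cst. Qed.

(** Logarithmic differentiation at a point where all factors are 1. *)
Lemma is_derive_prod1 I (s : seq I) (f : I -> K -> K) (df : I -> K) :
  (forall i, f i 0 = 1) -> (forall i, is_derive (0 : K) 1 (f i) (df i)) ->
  is_derive (0 : K) 1 (fun t => \prod_(i <- s) f i t) (\sum_(i <- s) df i).
Proof.
move=> f1 fd; elim: s => [|i s IH].
  rewrite big_nil (_ : (fun t => _) = fun=> 1); first exact: is_derive_const.
  by apply/funext => t; rewrite big_nil.
rewrite (_ : (fun t => _) = (fun t => f i t * \prod_(j <- s) f j t)); last first.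
  by apply/funext => t; rewrite big_cons.
apply: is_derive_eq (is_derive_mul (fd i) IH) _.
by rewrite /= f1 mul1r big_cons [X in _ + X * _]big1 ?mul1r 1?addrC.
Qed.

Lemma is_derive_exp1 f (df : K) n : f 0 = 1 -> is_derive (0 : K) 1 f df ->
  is_derive (0 : K) 1 (fun t => f t ^+ n) (df *+ n).
Proof.
move=> f1 fd; have := is_derive_prod1 (iota 0 n) (fun=> f1) (fun=> fd).
rewrite big_const_seq count_predT size_iota iter_addr_0.
rewrite (_ : (fun t => _) = (fun t => f t ^+ n))//; apply/funext => t.
by rewrite big_const_seq count_predT size_iota iter_mulr_1.
Qed.

(** Derivative at t = 0 of the transformation rule of the discriminant, when the
matrix with rows (A, B) and (E, F) is the identity at t = 0. *)
Lemma derive_homography_identity (G A B E F : K -> K) (g A' B' E' F' : K)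
    (p : seq K) (m n : nat) :
  is_derive (0 : K) 1 G g -> is_derive (0 : K) 1 A A' ->
  is_derive (0 : K) 1 B B' -> is_derive (0 : K) 1 E E' ->
  is_derive (0 : K) 1 F F' -> A 0 = 1 -> B 0 = 0 -> E 0 = 0 -> F 0 = 1 ->
  (\forall t \near (0 : K), G t * (\prod_(z <- p) (A t + B t * z)) ^+ m =
    (A t * F t - B t * E t) ^+ n * G 0) ->
  g + G 0 * (\sum_(z <- p) (A' + B' * z)) *+ m = G 0 * (A' + F') *+ n.
Proof.
move=> Gd Ad Bd Ed Fd A0 B0 E0 F0 e.
pose N t := \prod_(z <- p) (A t + B t * z).
have N1 : N 0 = 1 by rewrite /N big1_seq// => z _; rewrite A0 B0 mul0r addr0.
have Nd : is_derive (0 : K) 1 N (\sum_(z <- p) (A' + B' * z)).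
  apply: (@is_derive_prod1 _ p (fun z t => A t + B t * z) (fun z => A' + B' * z)) => z.
    by rewrite A0 B0 mul0r addr0.
  apply: is_derive_eq (is_derive_add Ad (is_derive_mul Bd (is_derive_const z))) _.
  by rewrite mulr0 add0r mulrC.
pose D t := A t * F t + (- 1) * (B t * E t).
have D1 : D 0 = 1 by rewrite /D A0 B0 F0 mul0r mulr0 addr0 mulr1.
have Dd : is_derive (0 : K) 1 D (A' + F').
  apply: is_derive_eq (is_derive_add (is_derive_mul Ad Fd)
    (is_derive_mul (is_derive_const (-1)) (is_derive_mul Bd Ed))) _.
  by rewrite A0 B0 E0 F0; ring.
have [_ L] := is_derive_mul Gd (is_derive_exp1 m N1 Nd).
have [_ R] := is_derive_mul (is_derive_exp1 n D1 Dd) (is_derive_const (G 0)).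
have : 'D_1 (fun t => G t * N t ^+ m) 0 = 'D_1 (fun t => D t ^+ n * G 0) 0.
  apply: near_eq_derive; apply: filterS e => t; rewrite /N /D => ->.
  by rewrite mulN1r.
by rewrite L R N1 !expr1n mul1r mulr0 add0r addrC -!mulrnAr.
Qed.

End DerivativesAtOne.

Section DiscriminantAlongFlow.
Variables (R : realType) (d : nat).
Local Notation C := (Cplx R).
Variable a : 'I_d.+1 -> 'rV[C]_2 -> C.
Implicit Type q : 'rV[C]_2.

(** A homography that is injective on the roots at q and maps them to roots at q'
maps them to all the roots at q', because there are at most d of them. *)
Lemma web_delta_homography q q' (A B E F : C) (p : d.-tuple C) :
  a ord0 q != 0 -> a ord0 q' != 0 -> uniq p ->
  pres_at a q = a ord0 q *: \prod_(c <- p) ('X - c%:P) ->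
  A * F - B * E != 0 ->
  (forall z, root (pres_at a q) z ->
    A + B * z != 0 /\ root (pres_at a q') ((E + F * z) / (A + B * z))) ->
  web_delta a q' * (\prod_(z <- p) (A + B * z)) ^+ (2 * d.-1) =
  (A * F - B * E) ^+ (d * d.-1) * web_delta a q.
Proof.
move=> a0 a0' up PE det0 pz.
have proot z : z \in p -> root (pres_at a q) z.
  by rewrite PE rootZ// root_prod_XsubC.
pose h z := (E + F * z) / (A + B * z); pose p' := map_tuple h p.
have up' : uniq p'.
  rewrite map_inj_in_uniq// => x y /proot/pz[x0 _] /proot/pz[y0 _] hxy.
  have : (A * F - B * E) * (x - y) = 0.
    have : h x * (A + B * x) * (A + B * y) = h y * (A + B * y) * (A + B * x).
      by rewrite hxy mulrAC.
    rewrite !divfK// => /eqP; rewrite -subr_eq0 => /eqP <-; ring.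
  by move/eqP; rewrite mulf_eq0 (negPf det0) subr_eq0 => /eqP.
have rp' : all (root (pres_at a q')) p'.
  by apply/allP => _ /mapP[z /proot/pz[_ ?] ->].
have PE' : pres_at a q' = a ord0 q' *: \prod_(c <- p') ('X - c%:P).
  have := all_roots_prod_XsubC _ rp'.
  rewrite /pres_at size_pres_poly_eq// size_tuple lead_coef_pres_poly//; apply=> //.
  by rewrite uniq_rootsE.
rewrite (web_delta_roots a0 PE) (web_delta_roots a0' PE').
have pn i : A + B * tnth p i != 0 by have [] := pz _ (proot _ (mem_tnth i p)).
rewrite -(square_differences_homography (p := p) (p' := p') pn).
  by rewrite big_tuple.
by move=> i; rewrite tnth_map.
Qed.

End DiscriminantAlongFlow.

(** * The cofactor *)

Lemma cofactor_identity (K : comNzRingType) (g w a b f s : K) (d m : nat) :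
  g + w * (a *+ d + b * - s) *+ (2 * m) = w * (a + f) *+ (d * m) ->
  g = ((d * m)%:R * (f - a) + (2 * m)%:R * (s * b)) * w.
Proof.
move=> e; apply: (addIr (w * (a *+ d + b * - s) *+ (2 * m))).
rewrite e -[w * _ *+ _]mulr_natr -[w * _ *+ (2 * m)]mulr_natr -[a *+ d]mulr_natr.
by rewrite !natrM; ring.
Qed.

Section Cofactor.
Variables (R : realType) (d : nat).
Local Notation C := (Cplx R).
Variables (U : set 'rV[C]_2) (a : 'I_d.+1 -> 'rV[C]_2 -> C).
Variables (alpha1 alpha2 : 'rV[C]_2 -> C).
Hypothesis d_gt0 : (0 < d)%N.
Hypothesis a_analytic : forall i, analytic_on U (a i).
Hypothesis alpha1_analytic : analytic_on U alpha1.
Hypothesis alpha2_analytic : analytic_on U alpha2.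
Implicit Type q : 'rV[C]_2.

Let a1 : 'rV[C]_2 -> C := a (Ordinal (d_gt0 : (1 < d.+1)%N)).

Let dx (f : 'rV[C]_2 -> C) q : C := 'D_(delta_mx 0 0) f q.
Let dy (f : 'rV[C]_2 -> C) q : C := 'D_(delta_mx 0 1) f q.

Lemma vfield_appE (f : 'rV[C]_2 -> C) q :
  vfield_app alpha1 alpha2 f q = alpha1 q * dx f q + alpha2 q * dy f q.
Proof.
by rewrite /vfield_app !vec2_delta !scale1r !scale0r addr0 add0r.
Qed.

(** The coefficient of degree d - 1. *)
Lemma sum_roots q (p : d.-tuple C) : a ord0 q != 0 ->
  pres_at a q = a ord0 q *: \prod_(c <- p) ('X - c%:P) ->
  \sum_(z <- p) z = - (a1 q / a ord0 q).
Proof.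
move=> a0 PE; have := coef_roots (Ordinal (d_gt0 : (1 < d.+1)%N)) a0 PE.
rewrite -/(a1 q) /= subn1 -[X in _`_X.-1](size_tuple p) coefPn_prod_XsubC.
  by move=> <-; rewrite opprK.
by rewrite size_tuple -lt0n.
Qed.

(** Logarithmic derivative along X of the product of the (p_i - p_j)^2; the sum of the
roots has been replaced by - a_1 / a_0. *)
Definition delta_cofactor q : C :=
  (d * d.-1)%:R * (dy alpha2 q - dx alpha1 q) +
  (2 * d.-1)%:R * (a1 q / a ord0 q * dy alpha1 q).

(** The transformation rule holds at all small times, and is differentiated at 0. *)
Lemma web_delta_symmetry q : web_symmetry U a alpha1 alpha2 ->
  regular_locus U a q -> a ord0 q != 0 ->
  vfield_app alpha1 alpha2 (web_delta a) q = delta_cofactor q * web_delta a q.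
Proof.
move=> sym rq a0; have [Uq res0] := rq.
have [V [r [phi [[openV Vq _ r0] phi_an [phi0 _] phiX phiT]]]] := sym q rq.
have [p _ PE] := roots_seqP (b := a ^~ q) a0.
have up := uniq_roots_regular a0 res0 PE.
have aq i : analytic_at (a i) q by exact: a_analytic.
pose alpha j y := vec2 (alpha1 y) (alpha2 y) 0 j.
(* the entries of the Jacobian matrix of the flow at q, as functions of time *)
have [J [J0 Jd JD]] : exists J : 'I_2 -> 'I_2 -> C -> C, [/\
    forall j k, J j k 0 = (j == k)%:R,
    forall j k, is_derive (0 : C) 1 (J j k) ('D_(delta_mx 0 k) (alpha j) q) &
    forall t z, `|t| < r ->
      'D_(vec2 1 z) (phi t) q = \row_j (J j 0 t + J j 1 t * z)].
  exists (flow_jacobian phi q); split.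
  - by move=> j k; exact: (flow_jacobian0 openV phi0 j k Vq).
  - by move=> j k; exact: (flow_jacobian_velocity openV r0 phi_an phiX j k Vq).
  - by move=> t z tr; exact: (derive_flow phi_an z tr Vq).
have gd : is_derive (0 : C) 1 (fun t => phi t q) (vec2 (alpha1 q) (alpha2 q)).
  exact: (flow_velocity r0 phi_an phiX Vq).
have gdiff : differentiable (fun t => phi t q) 0.
  by apply/derivable1_diffP; case: gd.
have gcont : (fun t => phi t q) @ 0 --> phi 0 q.
  exact: differentiable_continuous.
rewrite (phi0 q Vq) in gcont.
pose G t := web_delta a (phi t q).
have Gd : is_derive (0 : C) 1 G (vfield_app alpha1 alpha2 (web_delta a) q).
  have ddiff : differentiable (web_delta a) (phi 0 q).
    by rewrite phi0//; apply: analytic_differentiable; exact: analytic_web_delta.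
  have Gdiff : differentiable G 0 by exact: (differentiable_comp gdiff ddiff).
  have -> : vfield_app alpha1 alpha2 (web_delta a) q = 'D_1 G 0.
    rewrite (deriveE _ Gdiff) (diff_comp gdiff ddiff) /= -(deriveE _ gdiff).
    have [_ ->] := gd; rewrite phi0// vec2_delta linearD !linearZ /=.
    by rewrite phi0// in ddiff; rewrite vfield_appE /dx /dy !(deriveE _ ddiff).
  by apply: derivableP; exact: diff_derivable.
have detd : is_derive (0 : C) 1 (fun t => J 0 0 t * J 1 1 t + (-1) * (J 0 1 t * J 1 0 t))
    _ := is_derive_add (is_derive_mul (Jd 0 0) (Jd 1 1)) (is_derive_mul
    (is_derive_const (-1)) (is_derive_mul (Jd 0 1) (Jd 1 0))).
have det_neq0 : \forall t \near (0 : C), J 0 0 t * J 1 1 t - J 0 1 t * J 1 0 t != 0.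
  have detc : {for (0 : C), continuous (fun t => J 0 0 t * J 1 1 t +
      (-1) * (J 0 1 t * J 1 0 t))}.
    by apply/differentiable_continuous/derivable1_diffP; case: detd.
  have det0 : J 0 0 0 * J 1 1 0 + (-1) * (J 0 1 0 * J 1 0 0) != 0.
    by rewrite !J0 /= !mulr0 addr0 mulr1 oner_neq0.
  by apply: filterS (cvgr_neq0 _ detc det0) => t; rewrite mulN1r.
have a0_neq0 : \forall t \near (0 : C), a ord0 (phi t q) != 0.
  exact: gcont (near_neq0 (aq ord0) a0).
have t_small : \forall t \near (0 : C), `|t| < r by exact: nbhs0_lt.
(* the tangent vector (1, z) at q is sent to some c (1, z'), so that the homography
   with matrix J sends the root z at q to the root z' at phi t q *)
have main : \forall t \near (0 : C),
    G t * (\prod_(z <- p) (J 0 0 t + J 0 1 t * z)) ^+ (2 * d.-1) =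
    (J 0 0 t * J 1 1 t - J 0 1 t * J 1 0 t) ^+ (d * d.-1) * G 0.
  near=> t.
  have tr : `|t| < r by near: t.
  have at0 : a ord0 (phi t q) != 0 by near: t.
  have dt0 : J 0 0 t * J 1 1 t - J 0 1 t * J 1 0 t != 0 by near: t.
  rewrite /G phi0//; apply: web_delta_homography => // z Pz.
  have [_ /(_ (vec2 1 z))] := phiT t q tr Vq; case.
    by exists 1, z; rewrite oner_neq0 scale1r.
  move=> c [z' [c0 Pz' e]].
  move: e; rewrite JD// => /rowP e.
  have e0 : J 0 0 t + J 0 1 t * z = c by have := e 0; rewrite !mxE /= mulr1.
  have e1 : J 1 0 t + J 1 1 t * z = c * z' by have := e 1; rewrite !mxE.
  split; first by rewrite e0.
  have -> : (J 1 0 t + J 1 1 t * z) / (J 0 0 t + J 0 1 t * z) = z'.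
    by rewrite e0 e1 [c * z']mulrC mulfK.
  exact: Pz'.
have := derive_homography_identity Gd (Jd 0 0) (Jd 0 1) (Jd 1 0) (Jd 1 1)
  (J0 0 0) (J0 0 1) (J0 1 0) (J0 1 1) main.
have -> : alpha 0 = alpha1 by apply/funext => y; rewrite /alpha mxE.
have -> : alpha 1 = alpha2 by apply/funext => y; rewrite /alpha mxE.
have -> : G 0 = web_delta a q by rewrite /G phi0.
rewrite big_split/= -mulr_sumr (sum_roots a0 PE) big_const_seq count_predT.
rewrite iter_addr_0 size_tuple.
rewrite /delta_cofactor /dx /dy; move: ('D__ alpha1 q) ('D__ alpha1 q).
move: ('D__ alpha2 q) (web_delta a q) (vfield_app _ _ _ q) => f w g b' a' e.
exact: cofactor_identity.
Unshelve. all: by end_near. Qed.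

Definition discriminant_cofactor q : C :=
  (2 * d - 2)%:R * ((alpha1 q * dx (a ord0) q + alpha2 q * dy (a ord0) q) /
    a ord0 q) + delta_cofactor q.

Lemma web_discriminant_symmetry q : web_symmetry U a alpha1 alpha2 ->
  regular_locus U a q -> a ord0 q != 0 ->
  vfield_app alpha1 alpha2 (web_discriminant a) q =
  discriminant_cofactor q * web_discriminant a q.
Proof.
move=> sym rq a0; have [Uq _] := rq.
have aq i : analytic_at (a i) q by exact: a_analytic.
have deltaq := analytic_web_delta aq a0.
set m := (2 * d - 2)%N.
have dD v : 'D_v (web_discriminant a) q = a ord0 q ^+ m * 'D_v (web_delta a) q +
    web_delta a q * (m%:R * a ord0 q ^+ m.-1 * 'D_v (a ord0) q).
  have av : derivable (a ord0) q v.
    exact/diff_derivable/(analytic_differentiable (aq ord0)).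
  have dv : derivable (web_delta a) q v.
    exact/diff_derivable/(analytic_differentiable deltaq).
  rewrite (_ : web_discriminant a = (a ord0) ^+ m * web_delta a).
    by rewrite (deriveM (derivableX (n := m) av) dv) (deriveX m av) exprfctE.
  by apply/funext => x; rewrite web_discriminantE /= exprfctE.
have := web_delta_symmetry sym rq a0.
rewrite !vfield_appE /discriminant_cofactor /dx /dy !dD web_discriminantE -/m => e.
rewrite mulrDl [delta_cofactor q * _]mulrCA -e.
have -> : m%:R * a ord0 q ^+ m.-1 = m%:R / a ord0 q * a ord0 q ^+ m.
  case: (m) => [|k]; first by rewrite !mul0r.
  by rewrite exprS mulrA divfK.
move: ('D__ (a ord0) q) ('D__ (a ord0) q) ('D__ (web_delta a) q) => u1 u2 u3.
move: ('D__ (web_delta a) q) (web_delta a q) (alpha1 q) (alpha2 q).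
move: (a ord0 q ^+ m) (a ord0 q)^-1 m%:R => v1 v2 v3 u4 w c1 c2.
by ring.
Qed.

Lemma discriminant_cofactor_analytic q : U q -> a ord0 q != 0 ->
  analytic_at discriminant_cofactor q.
Proof.
move=> Uq a0.
have aq i : analytic_at (a i) q by exact: a_analytic.
have iq := analyticV a0 (aq ord0).
have alpha1q : analytic_at alpha1 q by exact: alpha1_analytic.
have alpha2q : analytic_at alpha2 q by exact: alpha2_analytic.
have dfq k f (fq : analytic_at f q) :
    analytic_at (fun y => 'D_(delta_mx 0 k) f y) q := analytic_derive k fq.
have cq (c : C) : analytic_at (fun=> c) q := analytic_cst c q.
have t1 := analyticD (analyticM alpha1q (dfq 0 _ (aq ord0)))
  (analyticM alpha2q (dfq 1 _ (aq ord0))).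
have t2 := analyticD (dfq 1 _ alpha2q) (analyticN (dfq 0 _ alpha1q)).
have t3 := analyticM (analyticM (aq (Ordinal (d_gt0 : (1 < d.+1)%N))) iq)
  (dfq 1 _ alpha1q).
exact: (analyticD (analyticM (cq (2 * d - 2)%:R) (analyticM t1 iq))
  (analyticD (analyticM (cq (d * d.-1)%:R) t2) (analyticM (cq (2 * d.-1)%:R) t3))).
Qed.

End Cofactor.

Theorem mainTheorem3 (R : realType) (d : nat) (U : set 'rV[Cplx R]_2)
    (a : 'I_d.+1 -> 'rV[Cplx R]_2 -> Cplx R)
    (alpha1 alpha2 : 'rV[Cplx R]_2 -> Cplx R)
    (d_gt0 : (0 < d)%N)
    (openU : open U)
    (a_analytic : forall i, analytic_on U (a i))
    (degree_d : size (pres_poly a) = d.+1)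
    (R_neq0 : U `<=` closure (regular_locus U a))
    (alpha1_analytic : analytic_on U alpha1)
    (alpha2_analytic : analytic_on U alpha2)
    (X_symmetry : web_symmetry U a alpha1 alpha2) :
  is_darboux (U `&` [set q | a ord0 q != 0]) alpha1 alpha2
    (web_discriminant a).
Proof.
have Dan q : U q -> a ord0 q != 0 -> analytic_at (web_discriminant a) q.
  by move=> Uq a0; apply: analytic_web_discriminant => // i; exact: a_analytic.
split; first by move=> q [Uq a0]; exact: Dan.
exists (discriminant_cofactor a alpha1 alpha2 d_gt0); split.
  by move=> q [Uq a0]; exact: (discriminant_cofactor_analytic d_gt0 a_analytic).
move=> q [Uq a0].
(* X(Delta) - K Delta: if it did not vanish at q, then neither it nor a_0 would vanish
   at some regular point near q *)
pose E x := alpha1 x * 'D_(delta_mx 0 0) (web_discriminant a) x +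
  alpha2 x * 'D_(delta_mx 0 1) (web_discriminant a) x -
  discriminant_cofactor a alpha1 alpha2 d_gt0 x * web_discriminant a x.
have alpha1q : analytic_at alpha1 q by exact: alpha1_analytic.
have alpha2q : analytic_at alpha2 q by exact: alpha2_analytic.
have Kq := discriminant_cofactor_analytic d_gt0 a_analytic alpha1_analytic
  alpha2_analytic Uq a0.
have Dq := Dan q Uq a0.
have Ean : analytic_at E q := analyticD (analyticD
  (analyticM alpha1q (analytic_derive 0 Dq))
  (analyticM alpha2q (analytic_derive 1 Dq))) (analyticN (analyticM Kq Dq)).
have EE x : E x = vfield_app alpha1 alpha2 (web_discriminant a) x -
  discriminant_cofactor a alpha1 alpha2 d_gt0 x * web_discriminant a x.
  by rewrite vfield_appE.
apply/eqP; rewrite -subr_eq0 -EE; apply/negPn/negP => E0.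
have near_q : \forall x \near q, E x != 0 /\ a ord0 x != 0.
  exact: filterI (near_neq0 Ean E0) (near_neq0 (a_analytic ord0 q Uq) a0).
have [x [rx [Ex ax]]] := R_neq0 q Uq _ near_q.
move: Ex; rewrite EE (web_discriminant_symmetry d_gt0 a_analytic)//.
by rewrite subrr eqxx.
Qed.
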